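(* Let $\mathbf{x}=x_1,\dots,x_n$ be indeterminates, let $\mathbf{f}(\mathbf{x})$ be a zero-dimensional complete intersection of $n$ polynomials in $\mathbb{R}[\mathbf{x}]$, and let $F(\mathbf{a},\mathbf{x})\subset\mathbb{R}[\mathbf{a},\mathbf{x}]$ be a generically zero-dimensional family containing $\mathbf{f}(\mathbf{x})$, with independent parameters $\mathbf{a}=(a_1,\dots,a_m)$. Let $I$ be the ideal in $\mathbb{R}[\mathbf{x}]$ generated by $\mathbf{f}(\mathbf{x})$, assume that there exists an $I$-optimal subscheme $\mathcal{U}$ of $\mathbb{A}^m_{\mathbb{R}}$, and let $\alpha_I\in\mathcal{U}$ be the point in the parameter space which corresponds to $I$. If $\mu_{\mathbb{R},I}$ is the number of distinct real points in the fiber over $\alpha_I$ (i.e. real zeros of $I$), then there exists a non-empty open semi-algebraic subscheme $\mathcal{V}$ of $\mathcal{U}$ such that for every $\alpha\in\mathcal{V}$ the number of real points in the fiber over $\alpha$ is $\mu_{\mathbb{R},I}$.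
   Context: A set of $t$ polynomials in $K[x_1,\dots,x_n]$ ($K$ a field) generating an ideal $I$ is a complete intersection if $\dim(K[\mathbf{x}]/I)=n-t$; it is a zero-dimensional complete intersection if moreover $t=n$. Families (here with $K=\mathbb{R}$): $F(\mathbf{a},\mathbf{x})=\{F_1,\dots,F_n\}\subset K[\mathbf{a},\mathbf{x}]$ is a family of polynomial systems parametrized by $\mathbf{a}$, $I(\mathbf{a},\mathbf{x})$ is the ideal it generates in $K[\mathbf{a},\mathbf{x}]$, $\mathcal{S}=\mathbb{A}^m_K$ is the parameter scheme, and $\Phi:\operatorname{Spec}(K[\mathbf{a},\mathbf{x}]/I(\mathbf{a},\mathbf{x}))\to\mathcal{S}$ is the associated morphism. The parameters are independent if $\mathcal{S}=\mathbb{A}^m_K$ and $I(\mathbf{a},\mathbf{x})\cap K[\mathbf{a}]=(0)$. $F(\mathbf{a},\mathbf{x})$ is a generically zero-dimensional family containing $\mathbf{f}(\mathbf{x})$ if $\mathbf{f}(\mathbf{x})$ is a member of the family (i.e. $\mathbf{f}(\mathbf{x})=F(\alpha_I,\mathbf{x})$ for some parameter value $\alpha_I$) and the generic member of the family is a zero-dimensional complete intersection (in particular $K(\mathbf{a})[\mathbf{x}]/I(\mathbf{a},\mathbf{x})K(\mathbf{a})[\mathbf{x}]$ is a finite-dimensional $K(\mathbf{a})$-vector space). A dense Zariski-open subscheme $\mathcal{U}$ of $\mathcal{S}$ is $I$-optimal if $\Phi^{-1}(\mathcal{U})\to\mathcal{U}$ is smooth (all its fibers are zero-dimensional smooth complete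 intersections) and free (the coordinate ring of $\Phi^{-1}(\mathcal{U})$ is a free module over that of $\mathcal{U}$). A point of a fiber is real if its coordinates are real numbers. $\mathcal{V}$ is a subset of the real points of $\mathcal{U}$ which is open in the Euclidean topology of $\mathbb{R}^m$ and semi-algebraic. *)

(* Defs.v *)
From mathcomp Require Export all_boot all_order all_algebra.
From mathcomp Require Export fraction ring_quotient.
(* [mpoly] has to be imported before the analysis libraries: its notations
   clash with theirs in the other order. *)
From mathcomp Require Export mpoly.
From mathcomp Require Export boolp classical_sets functions cardinality reals.
From mathcomp Require Export topology normedtype.
Export numFieldNormedType.Exports.

Set Implicit Arguments.
Unset Strict Implicit.
Unset Printing Implicit Defensive.

Import Order.TTheory GRing.Theory Num.Theory.
Local Open Scope ring_scope.
Local Open Scope classical_set_scope.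

(* A quotient ring B/I is represented by the pair (B, I): elements of B/I are
   elements of B modulo I, and primes of B/I are the primes of B containing
   I. *)

Definition ideal_gen (B : comNzRingType) (k : nat) (F : 'I_k -> B) : set B :=
  [set g | exists c : 'I_k -> B, g = \sum_(i < k) c i * F i].

(* [idealr_closed] includes properness (1 is not in p). *)
Definition is_prime (B : comNzRingType) (p : set B) : Prop :=
  idealr_closed (mem p) /\ prime_idealr_closed (mem p).

Definition Spec (B : comNzRingType) (I : set B) : set (set B) :=
  [set p | is_prime p /\ I `<=` p].

Definition prime_chain (B : comNzRingType) (I : set B) (d : nat) : Prop :=
  exists P : 'I_d.+1 -> set B,
    (forall i, Spec I (P i)) /\
    (forall i j : 'I_d.+1, (i < j)%N -> P i `<` P j).

(* The Krull dimension of B/I is d; the zero ring has no dimension in nat. *)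
Definition krull_dim (B : comNzRingType) (I : set B) (d : nat) : Prop :=
  prime_chain I d /\ forall e, prime_chain I e -> (e <= d)%N.

(* dim (K[x]/(f)) = n - t, written without truncated subtraction. *)
Definition complete_intersection (K : fieldType) (n t : nat)
    (f : 'I_t -> {mpoly K[n]}) : Prop :=
  exists2 d, krull_dim (ideal_gen f) d & (d + t = n)%N.

Definition zero_dim_complete_intersection (K : fieldType) (n : nat)
    (f : 'I_n -> {mpoly K[n]}) : Prop :=
  complete_intersection f.

(* Smoothness over K by the Jacobian criterion: at every point of
   Spec (K[x]/(f)), closed or not, the Jacobian matrix of the n equations in n
   variables has rank n over the residue field of that point. *)
Definition smooth_zero_dim_complete_intersection (K : fieldType) (n : nat)
    (f : 'I_n -> {mpoly K[n]}) : Prop :=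
  zero_dim_complete_intersection f /\
  forall q, Spec (ideal_gen f) q -> ~ q (\det (\matrix_(i, j) (f i)^`M(j))).

Definition zariski_open (B : comNzRingType) (I : set B) (W : set (set B)) :
    Prop :=
  exists E : set B, W = [set p | Spec I p /\ ~ (E `<=` p)].

Definition zariski_dense (B : comNzRingType) (I : set B) (W : set (set B)) :
    Prop :=
  forall W', zariski_open I W' -> W' !=set0 -> W' `&` W !=set0.

(* Structure sheaf of Spec (B/I). An element of the local ring at p is
   represented by a pair (numerator, denominator), and a section over an open
   set W by a function choosing such a pair at each point of W that is locally
   given by a single fraction a/g. The values outside W are irrelevant. *)

Definition frac_eq (B : comNzRingType) (I p : set B) (s t : B * B) : Prop :=
  exists2 u, ~ p u & I (u * (s.1 * t.2 - t.1 * s.2)).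

Definition is_section (B : comNzRingType) (I : set B) (W : set (set B))
    (s : set B -> B * B) : Prop :=
  forall p, W p -> exists (V : set (set B)) (a g : B),
    [/\ zariski_open I V, V p, V `<=` W &
        forall q, V q -> [/\ ~ q g, ~ q (s q).2 & frac_eq I q (s q) (a, g)]].

Definition section_eq (B : comNzRingType) (I : set B) (W : set (set B))
    (s t : set B -> B * B) : Prop :=
  forall p, W p -> frac_eq I p (s p) (t p).

Definition section0 (B : comNzRingType) : set B -> B * B := fun=> (0, 1).

Definition section_add (B : comNzRingType) (s t : set B -> B * B) :
    set B -> B * B :=
  fun p => ((s p).1 * (t p).2 + (t p).1 * (s p).2, (s p).2 * (t p).2).

(* Product of s with the pullback of c along the map of spectra
   q |-> phi^-1(q) induced by phi. *)
Definition section_act (A B : comNzRingType) (phi : A -> B)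
    (c : set A -> A * A) (s : set B -> B * B) : set B -> B * B :=
  fun q => let cq := c (phi @^-1` q) in
           (phi cq.1 * (s q).1, phi cq.2 * (s q).2).

(* The sections over W, an open subset of Spec (B/J), form a free module over
   the sections over U, an open subset of Spec (A/I): there is a basis b,
   indexed by a possibly infinite type T. *)
Definition free_sections (A B : comNzRingType) (phi : A -> B)
    (I : set A) (U : set (set A)) (J : set B) (W : set (set B)) : Prop :=
  exists (T : Type) (b : T -> set B -> B * B),
    [/\ forall t, is_section J W (b t),
        forall s, is_section J W s ->
          exists (k : nat) (t : 'I_k -> T) (c : 'I_k -> set A -> A * A),
            (forall i, is_section I U (c i)) /\
            section_eq J W s
              (\big[@section_add B/@section0 B]_(i < k)
                  section_act phi (c i) (b (t i)))
      & forall (k : nat) (t : 'I_k -> T) (c : 'I_k -> set A -> A * A),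
          injective t -> (forall i, is_section I U (c i)) ->
          section_eq J W
            (\big[@section_add B/@section0 B]_(i < k)
                section_act phi (c i) (b (t i)))
            (@section0 B) ->
          forall i, section_eq I U (c i) (@section0 A)].

(* Families: K[a, x] is the iterated polynomial ring K[a][x]. *)

Definition member (K : fieldType) (n m : nat)
    (F : 'I_n -> {mpoly {mpoly K[m]}[n]}) (alpha : 'rV[K]_m) :
    'I_n -> {mpoly K[n]} :=
  fun i => map_mpoly (meval (alpha ord0)) (F i).

Definition independent_parameters (K : fieldType) (n m : nat)
    (F : 'I_n -> {mpoly {mpoly K[m]}[n]}) : Prop :=
  @mpolyC n {mpoly K[m]} @^-1` ideal_gen F = [set 0].

(* The generic member is the one over the field K(a). *)
Definition generic_member (K : fieldType) (n m : nat)
    (F : 'I_n -> {mpoly {mpoly K[m]}[n]}) :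
    'I_n -> {mpoly {fraction {mpoly K[m]}}[n]} :=
  fun i => map_mpoly (@tofrac {mpoly K[m]}) (F i).

Definition generically_zero_dim_family (K : fieldType) (n m : nat)
    (F : 'I_n -> {mpoly {mpoly K[m]}[n]}) (f : 'I_n -> {mpoly K[n]}) : Prop :=
  (exists alpha : 'rV[K]_m, member F alpha = f) /\
  zero_dim_complete_intersection (generic_member F).

(* phi : A -> L is the canonical map to the residue field at p, i.e. L is
   Frac (A/p). *)
Definition is_residue_field (A : comNzRingType) (p : set A) (L : fieldType)
    (phi : {rmorphism A -> L}) : Prop :=
  phi @^-1` [set 0] = p /\
  forall z : L, exists a b : A, phi b != 0 /\ z = phi a / phi b.

(* The inverse image of U under Spec (K[a, x]/I(a, x)) -> A^m. *)
Definition total_space (K : fieldType) (n m : nat)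
    (F : 'I_n -> {mpoly {mpoly K[m]}[n]}) (U : set (set {mpoly K[m]})) :
    set (set {mpoly {mpoly K[m]}[n]}) :=
  [set q | Spec (ideal_gen F) q /\ U (@mpolyC n {mpoly K[m]} @^-1` q)].

(* U is a set of points of the scheme A^m = Spec K[a]; the fibers are taken
   over all of them. *)
Definition I_optimal (K : fieldType) (n m : nat)
    (F : 'I_n -> {mpoly {mpoly K[m]}[n]}) (U : set (set {mpoly K[m]})) : Prop :=
  [/\ zariski_open [set 0] U,
      zariski_dense [set 0] U,
      forall p, U p ->
        forall (L : fieldType) (phi : {rmorphism {mpoly K[m]} -> L}),
          is_residue_field p phi ->
          smooth_zero_dim_complete_intersection (fun i => map_mpoly phi (F i))
    & free_sections (@mpolyC n {mpoly K[m]})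
        [set 0] U (ideal_gen F) (total_space F U)].

(* The K-rational points of U, a point being identified with its maximal
   ideal. *)
Definition rational_points (K : fieldType) (m : nat)
    (U : set (set {mpoly K[m]})) : set 'rV[K]_m :=
  [set alpha | U [set c | c.@[alpha ord0] = 0]].

Definition zeros (K : fieldType) (n : nat) (f : 'I_n -> {mpoly K[n]}) :
    set 'rV[K]_n :=
  [set x | forall i, (f i).@[x ord0] = 0].

Definition semialgebraic (R : realType) (m : nat) (V : set 'rV[R]_m) : Prop :=
  exists s : seq (seq {mpoly R[m]} * seq {mpoly R[m]}),
    V = [set alpha | exists2 c, c \in s &
           (forall p, p \in c.1 -> p.@[alpha ord0] = 0) /\
           (forall q, q \in c.2 -> 0 < q.@[alpha ord0])].

(* Main.v *)
From HB Require Import structures.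
From mathcomp Require Import generic_quotient ring lra.
From mathcomp Require Import interval_inference sequences.
Require Import Defs.

(** The set [V] is a small ball around [alphaI] for the maximum norm: near
    [alphaI] real zeros of the fiber neither disappear, nor split or merge, nor
    come in from infinity.

    Zeros persist and stay simple. The fiber over [alphaI] is smooth, so the
    Jacobian matrix is invertible at each of its real zeros [z]
    ([smooth_zero]). The difference F(alpha, x) - F(alpha, y) factors as
    (x - y) Q(alpha, x, y) with Q continuous and equal to the transposed
    Jacobian matrix on the diagonal ([feval_divided_difference]); hence the
    simplified Newton map x - F(alpha, x) Q(alphaI, z, z)^-1 is a contraction
    of a fixed ball around [z], for all alpha near [alphaI], and its only fixed
    point is the only zero of the fiber over alpha in that ball
    ([locally_unique_zero]).

    Zeros do not come from infinity. This is where freeness is used: each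
    coordinate x_j satisfies, on the real fibers near [alphaI], an equation
    g x_j^N = sum_(i < N) d_i x_j^i with coefficients in R[a] and
    g(alphaI) <> 0, so it stays bounded. To find the equation, the generic
    fiber has dimension zero, so x_j is algebraic over R(a) modulo the family
    ([krull_dim0_algebraic]). Expand the powers of x_j in a basis of the
    sections over the inverse image of [U]; the coordinates are elements of
    R(a) that are regular at every point of [U] ([coordinates_exist]). By
    algebraicity only finitely many basis elements occur in all these powers.
    After multiplication by denominators that do not vanish at [alphaI], the
    coordinate vectors of the powers of x_j form a sequence in a finite power
    of R[a], and by the Hilbert basis theorem one of them is a combination of
    the previous ones ([free_integral]).

    Finally, all zeros over parameters near [alphaI] lie in a fixed compact
    box. Away from the small balls around the zeros over [alphaI], the family
    has no zero on the box at [alphaI], hence none nearby, by compactness; and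
    each ball contains exactly one zero ([card_zeros_near]). *)

Set Implicit Arguments.
Unset Strict Implicit.
Unset Printing Implicit Defensive.
Import Order.TTheory GRing.Theory Num.Theory.
Local Open Scope ring_scope.
Local Open Scope classical_set_scope.
Local Open Scope card_scope.
Local Notation "x %:F" := (tofrac x).

(** * Ideals and the Hilbert basis theorem *)

(** Unlike induction on monomials, this form matches properties that are
    proved by closure under the ring operations. *)
Lemma mpoly_ring_ind (A : comNzRingType) (n : nat) (S : {mpoly A[n]} -> Prop) :
  (forall c, S c%:MP) -> (forall i, S 'X_i) ->
  (forall p q, S p -> S q -> S (p + q)) ->
  (forall p q, S p -> S q -> S (p * q)) -> forall p, S p.
Proof.
move=> SC SX SD SM; elim/mpolyind => [|c m p _ _ Sp].
  by rewrite -mpolyC0; exact: SC.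
apply: (SD) => //; rewrite -mul_mpolyC; apply: (SM); first exact: SC.
rewrite mpolyXE_id; apply: (big_ind S _ SM) => [|i _]; first exact: SC.
elim: (m i) => [|k IH]; first by rewrite expr0; exact: SC.
by rewrite exprS; exact: (SM).
Qed.

Section IdealGen.
Variables (B : comNzRingType) (k : nat) (F : 'I_k -> B).

Lemma ideal_gen0 : ideal_gen F 0.
Proof. by exists (fun=> 0); rewrite big1 // => i _; rewrite mul0r. Qed.

Lemma ideal_genD x y : ideal_gen F x -> ideal_gen F y -> ideal_gen F (x + y).
Proof.
move=> [c ->] [d ->]; exists (fun i => c i + d i).
by rewrite -big_split; apply: eq_bigr => i _; rewrite mulrDl.
Qed.

Lemma ideal_genM a x : ideal_gen F x -> ideal_gen F (a * x).
Proof.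
move=> [c ->]; exists (fun i => a * c i).
by rewrite mulr_sumr; apply: eq_bigr => i _; rewrite mulrA.
Qed.

Lemma ideal_gen_sum (I : Type) (r : seq I) (P : pred I) (E : I -> B) :
  (forall i, P i -> ideal_gen F (E i)) -> ideal_gen F (\sum_(i <- r | P i) E i).
Proof. by move=> FE; elim/big_ind: _ => //; [exact: ideal_gen0|exact: ideal_genD]. Qed.

Lemma ideal_gen_mem i : ideal_gen F (F i).
Proof.
exists (fun j => (j == i)%:R); rewrite (bigD1 i) //= eqxx mul1r.
by rewrite big1 ?addr0 // => j /negbTE ->; rewrite mul0r.
Qed.

End IdealGen.

Lemma ideal_gen_trans (B : comNzRingType) (k l : nat) (F : 'I_k -> B)
    (G : 'I_l -> B) x :
  (forall i, ideal_gen G (F i)) -> ideal_gen F x -> ideal_gen G x.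
Proof.
by move=> GF [c ->]; apply: ideal_gen_sum => i _; exact: ideal_genM.
Qed.

(** The module A^s is noetherian, stated with one sequence instead of chains of
    submodules: in every sequence of vectors ([e i j] is the [j]-th coordinate
    of the [i]-th vector), some vector is a combination of the preceding
    ones. *)
Definition noetherian (A : comNzRingType) (s : nat) : Prop :=
  forall e : nat -> nat -> A, exists (N : nat) (d : nat -> A),
    forall j, (j < s)%N -> e N j = \sum_(i < N) d i * e i j.

Definition prefix_ideal (A : comNzRingType) (e : nat -> A) (N : nat) : set A :=
  ideal_gen (fun i : 'I_N => e i).

Lemma prefix_ideal_mem (A : comNzRingType) (e : nat -> A) N i :
  (i < N)%N -> prefix_ideal e N (e i).
Proof. by move=> iN; exact: (ideal_gen_mem _ (Ordinal iN)). Qed.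

Lemma prefix_idealP (A : comNzRingType) (e : nat -> A) N x :
  prefix_ideal e N x <-> exists d : nat -> A, x = \sum_(i < N) d i * e i.
Proof.
split=> [[c ->]|[d ->]]; last by exists (fun i => d i).
exists (fun j => if insub j is Some i then c i else 0).
by apply: eq_bigr => i _; rewrite valK.
Qed.

(** If the ideals of the prefixes kept growing, the elements responsible for
    the growth would form a sequence in which no element is a combination of
    the preceding ones. *)
Lemma noetherian_stationary (A : comNzRingType) : noetherian A 1 ->
  forall e : nat -> A, exists N, forall k, (N <= k)%N -> prefix_ideal e N (e k).
Proof.
move=> noeA e; apply: contrapT => noN.
have ex N : exists k, (N <= k)%N /\ ~ prefix_ideal e N (e k).
  apply: contrapT => H; apply: noN; exists N => k Nk.
  by apply: contrapT => H'; apply: H; exists k.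
have [K KP] := choice ex.
(* A subsequence each of whose terms escapes the ideal of all earlier terms
   of the full sequence. *)
pose k j := iter j (fun l => K l.+1) (K 0%N).
have [N [d]] := noeA (fun i _ => e (k i)).
move=> /(_ 0%N isT) eN.
(* One past the previous index of the subsequence, so that k N = K M. *)
pose M := if N is N'.+1 then (k N').+1 else 0%N.
have kN : k N = K M by rewrite /M /k; case: (N).
have kmono i j : (i <= j)%N -> (k i <= k j)%N.
  move=> /subnK <-; elim: (j - i)%N => // l IH; rewrite addSn.
  exact: leq_trans IH (leq_trans (leqnSn _) (KP _).1).
apply: (KP M).2; rewrite -kN eN; apply: ideal_gen_sum => i _.
apply: ideal_genM; apply: prefix_ideal_mem.
rewrite /M; case: (N) i => [[]//|N' i] /=.
by rewrite ltnS kmono // -ltnS.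
Qed.

(** Induction on the rank. From some index on, the last coordinate is a
    combination of its first values; subtracting that combination of the first
    vectors kills the last coordinate, which leaves a sequence of smaller
    rank. *)
Lemma noetherian_rank (A : comNzRingType) s : noetherian A 1 -> noetherian A s.
Proof.
move=> noeA; elim: s => [|s IH] e; first by exists 0%N, (fun=> 0).
have [N HN] := noetherian_stationary noeA (fun i => e i s).
have /choice[c cP] : forall l, exists d : nat -> A,
    e (N + l)%N s = \sum_(i < N) d i * e i s.
  by move=> l; apply/(prefix_idealP (fun i => e i s))/HN/leq_addr.
(* The vectors from index N on, corrected to have last coordinate 0. *)
pose e' l j := e (N + l)%N j - \sum_(i < N) c l i * e i j.
have e's l : e' l s = 0 by rewrite /e' -cP subrr.
have [M [d dP]] := IH e'.
have dP' j : (j < s.+1)%N -> e' M j = \sum_(i < M) d i * e' i j.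
  rewrite ltnS leq_eqVlt => /orP[/eqP ->|/dP //].
  by rewrite e's big1 // => i _; rewrite e's mulr0.
exists (N + M)%N, (fun i => if (i < N)%N then c M i - \sum_(l < M) d l * c l i
                   else d (i - N)%N) => j js.
rewrite -(subrK (\sum_(i < N) c M i * e i j) (e (N + M)%N j)) -/(e' M j) dP' //.
rewrite big_split_ord /= [RHS]addrC.
under [X in _ = X + _]eq_bigr => i _ do rewrite ltnNge leq_addr /= addKn.
under [X in _ = _ + X]eq_bigr => i _ do rewrite ltn_ord mulrBl.
rewrite sumrB [RHS]addrCA [LHS]addrC; congr (_ + _).
rewrite /e'; under eq_bigr => i _ do rewrite mulrBr.
rewrite sumrB; congr (_ - _).
under eq_bigr => i _ do rewrite mulr_sumr.
rewrite exchange_big /=; apply: eq_bigr => i _; rewrite mulr_suml.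
by apply: eq_bigr => l _; rewrite mulrA.
Qed.

Lemma noetherian_field (K : fieldType) : noetherian K 1.
Proof.
move=> e; have [e00|e00] := eqVneq (e 0%N 0%N) 0.
  by exists 0%N, (fun=> 0) => -[|//] _; rewrite big_ord0.
exists 1%N, (fun=> e 1%N 0%N / e 0%N 0%N) => -[|//] _.
by rewrite big_ord1 mulfVK.
Qed.

Lemma noetherian_surj (A B : comNzRingType) (f : {rmorphism A -> B}) :
  (forall b, exists a, f a = b) -> noetherian A 1 -> noetherian B 1.
Proof.
move=> fsurj noeA e; have [g gK] := choice fsurj.
have [N [d dP]] := noeA (fun i j => g (e i j)).
exists N, (f \o d) => j js; rewrite -(gK (e N j)) dP // rmorph_sum.
by apply: eq_bigr => i _; rewrite rmorphM /= gK.
Qed.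

(** Hilbert basis theorem. In an ideal that is not finitely generated, choose
    repeatedly an element of least degree outside the ideal of the previous
    choices. A relation between the leading coefficients would produce an
    element of smaller degree that is still outside. *)
Lemma noetherian_poly (A : comNzRingType) :
  noetherian A 1 -> noetherian {poly A} 1.
Proof.
move=> noeA f; apply: contrapT => nof.
pose e i := f i 0%N.
have nof' N : ~ prefix_ideal e N (e N).
  move=> /prefix_idealP[d dP]; apply: nof; exists N, d => -[|//] _; exact: dP.
pose J : set {poly A} := [set g | exists M, prefix_ideal e M g].
have prefW M M' g : (M <= M')%N -> prefix_ideal e M g -> prefix_ideal e M' g.
  move=> MM'; apply: ideal_gen_trans => i.
  exact: prefix_ideal_mem (leq_trans (ltn_ord i) MM').
have JD x y : J x -> J y -> J (x + y).
  move=> [M Mx] [M' My]; exists (maxn M M'); apply: ideal_genD.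
    exact: prefW (leq_maxl _ _) Mx.
  exact: prefW (leq_maxr _ _) My.
have JM a x : J x -> J (a * x) by move=> [M Mx]; exists M; exact: ideal_genM.
pose sp (l : seq {poly A}) := prefix_ideal (nth 0 l) (size l).
(* h has least degree among the elements of J outside the ideal of l. *)
pose P l h := [/\ J h, ~ sp l h &
  forall h', J h' -> ~ sp l h' -> (size h <= size h')%N].
have exP l : (forall x, x \in l -> J x) -> exists h, P l h.
  move=> lJ.
  have [M HM] : exists M, forall x, x \in l -> prefix_ideal e M x.
    elim: l lJ => [|x l IH] lJ; first by exists 0%N.
    have [|M HM] := IH; first by move=> y yl; apply: lJ; rewrite inE yl orbT.
    have [|M' HM'] := lJ x; first exact: mem_head.
    exists (maxn M M') => y; rewrite inE => /orP[/eqP ->|/HM].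
      exact: prefW (leq_maxr _ _) HM'.
    exact: prefW (leq_maxl _ _).
  have eM : J (e M) /\ ~ sp l (e M).
    split; first by exists M.+1; exact: prefix_ideal_mem.
    move=> H; apply: (nof' M); move: H; apply: ideal_gen_trans => i.
    by apply: HM; exact: mem_nth.
  pose q s := `[< exists h, [/\ J h, ~ sp l h & size h = s] >].
  have exq : exists s, q s.
    by exists (size (e M)); apply/asboolP; exists (e M); case: eM.
  case: (ex_minnP exq) => s /asboolP[h [Jh slh <-]] smin.
  exists h; split=> // h' Jh' slh'; apply: smin; apply/asboolP.
  by exists h'.
have /choice[step stepP] : forall l, exists h,
    (forall x, x \in l -> J x) -> P l h.
  move=> l; have [lJ|nlJ] := pselect (forall x, x \in l -> J x).
    by have [h hP] := exP l lJ; exists h.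
  by exists 0.
pose ls k := iter k (fun l => rcons l (step l)) [::].
pose g k := step (ls k).
have lsE k : ls k = mkseq g k.
  by elim: k => // k IH; rewrite mkseqS -IH.
have Jls k x : x \in ls k -> J x.
  elim: k x => //= k IH x; rewrite mem_rcons inE => /orP[/eqP ->|]; last exact: IH.
  by case: (stepP _ IH).
have gP k : P (ls k) (g k) by apply/stepP/Jls.
have spE k h : sp (ls k) h <-> prefix_ideal g k h.
  rewrite lsE /sp size_mkseq; split; apply: ideal_gen_trans => i.
    by rewrite nth_mkseq //; exact: prefix_ideal_mem.
  rewrite -(nth_mkseq 0 g (ltn_ord i)); exact: prefix_ideal_mem.
have gsz i k : (i <= k)%N -> (size (g i) <= size (g k))%N.
  move=> ik; case: (gP i) => _ _; apply; case: (gP k) => // _ + _.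
  apply: contra_not => /spE H; apply/spE; move: H; apply: ideal_gen_trans => j.
  exact: prefix_ideal_mem (leq_trans (ltn_ord j) ik).
have [N [d]] := noeA (fun i _ => lead_coef (g i)).
move=> /(_ 0%N isT) lcN.
have [JN nN minN] := gP N.
(* c has the degree and the leading coefficient of g N. *)
pose c := \sum_(i < N) (d i *: 'X^(size (g N) - size (g i))) * g i.
have cN : prefix_ideal g N c.
  by apply: ideal_gen_sum => i _; apply/ideal_genM/prefix_ideal_mem.
have Jc : J (- c).
  rewrite -mulN1r; apply: (JM); rewrite /c; elim/big_ind: _ => //.
  - by exists 0%N; exact: ideal_gen0.
  - by move=> i _; apply: JM; case: (gP i).
have szN : (0 < size (g N))%N.
  rewrite lt0n size_poly_eq0; apply/eqP => g0; apply: nN; apply/spE.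
  by rewrite g0; exact: ideal_gen0.
have JgNc : J (g N - c) by exact: JD.
have /(minN _ JgNc) : ~ sp (ls N) (g N - c).
  move=> /spE H; apply: nN; apply/spE; rewrite -(subrK c (g N)).
  exact: ideal_genD.
rewrite leqNgt -(prednK szN) ltnS; apply/negP; rewrite negbK.
apply/leq_sizeP => j; rewrite leq_eqVlt coefB /c coef_sum => /orP[/eqP <-|jN].
  rewrite -[(g N)`__]/(lead_coef (g N)) lcN -sumrB big1 // => i _.
  rewrite -scalerAl coefZ coefXnM.
  have sz := gsz _ _ (ltnW (ltn_ord i)).
  have szi : (0 < size (g i))%N.
    rewrite lt0n size_poly_eq0; apply/eqP => g0.
    case: (gP i) => _ + _; apply; apply/spE.
    by rewrite g0; exact: ideal_gen0.
  have -> : ((size (g N)).-1 - (size (g N) - size (g i)) = (size (g i)).-1)%N.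
    by rewrite -!subn1 subnAC subKn.
  rewrite ltnNge.
  have := leq_sub2l (size (g N)) szi; by rewrite subn1 => -> /=; rewrite subrr.
have gj : (size (g N) <= j)%N by rewrite -(prednK szN).
rewrite (nth_default _ gj) sub0r big1 ?oppr0 // => i _.
rewrite -scalerAl coefZ coefXnM; case: ltnP => [_|jge]; first by rewrite mulr0.
rewrite nth_default ?mulr0 //.
have sz := gsz _ _ (ltnW (ltn_ord i)).
by rewrite leq_subRL // subnK.
Qed.

Lemma noetherian_mpoly (K : fieldType) n : noetherian {mpoly K[n]} 1.
Proof.
elim: n => [|n IH].
  apply: (@noetherian_surj K _ (@mpolyC 0 K) _ (@noetherian_field K)) => p.
  exists (p@_0%MM); apply/mpolyP => m; rewrite mcoeffC.
  have -> : m = 0%MM by apply/mnmP => -[].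
  by rewrite eqxx mulr1.
have cX : commr_rmorph (@mwiden n K) 'X_ord_max by move=> p; exact: mulrC.
pose h : {rmorphism _ -> _} := horner_morph cX.
apply: (@noetherian_surj _ _ h _ (noetherian_poly IH)) => p.
pose im x := exists a, h a = x.
apply: (@mpoly_ring_ind _ _ im).
- by move=> c; exists (c%:MP)%:P; rewrite /= horner_morphC /= mwidenC.
- move=> i; case: (unliftP ord_max i) => [j ->|->].
    exists ('X_j)%:P; rewrite /= horner_morphC /= mwidenX mnmwiden1.
    by congr ('X__); apply: val_inj => /=; rewrite /bump leqNgt ltn_ord.
  by exists 'X; rewrite /= horner_morphX.
- by move=> x y [a <-] [b <-]; exists (a + b); rewrite rmorphD.
- by move=> x y [a <-] [b <-]; exists (a * b); rewrite rmorphM.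
Qed.

(** * Prime ideals and dimension zero *)

Section Primes.
Variable B : comNzRingType.
Implicit Types (I J P S : set B).

Definition is_ideal J : Prop :=
  [/\ J 0, forall x y, J x -> J y -> J (x + y) & forall a x, J x -> J (a * x)].

Lemma is_ideal_gen k (F : 'I_k -> B) : is_ideal (ideal_gen F).
Proof. split; [exact: ideal_gen0|exact: ideal_genD|exact: ideal_genM]. Qed.

Lemma is_primeP P : is_prime P <->
  [/\ is_ideal P, ~ P 1 & forall u v, P (u * v) -> P u \/ P v].
Proof.
split=> [[[/set_mem P0 /negP P1 PDM] Pp]|[[P0 PD PM] P1 Pp]].
  have PD x y : P x -> P y -> P (x + y).
    by move=> /mem_set Px /mem_set Py; apply/set_mem; rewrite -[x]mul1r; apply: PDM.
  split; first split=> // a x /mem_set Px.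
  - by apply/set_mem; rewrite -[a * x]addr0; apply: PDM => //; apply/mem_set.
  - by move=> /mem_set.
  - by move=> u v /mem_set/Pp/orP[]/set_mem; [left|right].
split; first split; first exact/mem_set.
- by apply/negP => /set_mem.
- by move=> a u v /set_mem Pu /set_mem Pv; apply/mem_set/PD => //; exact: PM.
- by move=> u v /set_mem/Pp[] H; apply/orP; [left|right]; apply/mem_set.
Qed.

Lemma is_ideal_sum J (T : Type) (r : seq T) (E : T -> B) :
  is_ideal J -> (forall i, J (E i)) -> J (\sum_(i <- r) E i).
Proof. by move=> [J0 JD _] JE; elim/big_ind: _. Qed.

Definition adjoin J u : set B := [set x | exists a r, J a /\ x = a + r * u].

Lemma is_ideal_adjoin J u : is_ideal J -> is_ideal (adjoin J u).
Proof.
move=> [J0 JD JM]; split.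
- by exists 0, 0; rewrite mul0r addr0.
- move=> _ _ [a [r [Ja ->]]] [b [s [Jb ->]]]; exists (a + b), (r + s).
  by split; [exact: JD|rewrite mulrDl addrACA].
- move=> c _ [a [r [Ja ->]]]; exists (c * a), (c * r).
  by split; [exact: JM|rewrite mulrDr mulrA].
Qed.

Lemma sub_adjoin J u : J `<=` adjoin J u.
Proof. by move=> x Jx; exists x, 0; rewrite mul0r addr0. Qed.

Lemma mem_adjoin J u : is_ideal J -> adjoin J u u.
Proof. by move=> [J0 _ _]; exists 0, 1; rewrite mul1r add0r. Qed.

(** An ideal that is maximal among those containing [I] and disjoint from the
    multiplicative set [S] is prime: were [u] and [v] outside it, adjoining
    either would meet [S], and the product of the two elements found in [S]
    would lie in the ideal generated by [u * v]. *)
Lemma prime_avoiding I S : is_ideal I -> S 1 ->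
  (forall x y, S x -> S y -> S (x * y)) -> (forall x, I x -> ~ S x) ->
  exists P, [/\ is_prime P, I `<=` P & forall x, P x -> ~ S x].
Proof.
move=> idI S1 SM IS.
(* The empty set is included because it is the union of the empty chain. *)
pose Q J := J = set0 \/ [/\ is_ideal J, I `<=` J & forall x, J x -> ~ S x].
have [|A [QA Amax]] := @Zorn_bigcup _ Q.
  move=> F FQ Ftot.
  have [[X0 FX0 X00]|noX] := pselect (exists2 X, F X & X !=set0); last first.
    left; apply/seteqP; split=> // x [X FX Xx].
    by apply: noX; exists X => //; exists x.
  have FQ' X x : F X -> X x ->
      [/\ is_ideal X, I `<=` X & forall x, X x -> ~ S x].
    by move=> FX Xx; case: (FQ _ FX) => // XE; rewrite XE in Xx.
  case: X00 => x0 X0x0; have [[X0_0 _ _] IX0 _] := FQ' _ _ FX0 X0x0.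
  right; split.
  - split.
    + by exists X0.
    + move=> x y [X FX Xx] [Y FY Yy].
      case: (Ftot _ _ FX FY) => [XY|YX].
        exists Y => //; have [[_ YD _] _ _] := FQ' _ _ FY Yy.
        by apply: YD => //; exact: XY.
      exists X => //; have [[_ XD _] _ _] := FQ' _ _ FX Xx.
      by apply: XD => //; exact: YX.
    + move=> a x [X FX Xx]; exists X => //.
      by have [[_ _ XM] _ _] := FQ' _ _ FX Xx; exact: XM.
  - by move=> x Ix; exists X0 => //; exact: IX0.
  - by move=> x [X FX Xx]; have [_ _] := FQ' _ _ FX Xx; apply.
have QI : Q I by right; split.
have I0 : I 0 by case: idI.
case: QA => [A0|[idA IA AS]].
  exfalso; apply: (Amax I) => //; rewrite A0 classical_sets.properEneq; split=> //.
  by apply/eqP => E; rewrite -E in I0.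
have meet u : ~ A u -> exists a r, A a /\ S (a + r * u).
  move=> nAu; apply: contrapT => H.
  apply: (Amax (adjoin A u)).
    rewrite classical_sets.properEneq; split; last exact: sub_adjoin.
    by apply/eqP => E; apply: nAu; rewrite E; exact: mem_adjoin.
  right; split; first exact: is_ideal_adjoin.
    by move=> x /IA; exact: sub_adjoin.
  by move=> _ [a [r [Aa ->]]] SS; apply: H; exists a, r.
exists A; split=> //; apply/is_primeP; split=> //; first by move=> /AS.
move=> u v Auv; apply: contrapT => /not_orP[/meet[a [r [Aa Sa]]] /meet[b [s [Ab Sb]]]].
apply: (AS _ _ (SM _ _ Sa Sb)).
case: idA => _ AD AM; rewrite mulrDl; apply: (AD).
  by rewrite mulrC; exact: AM.
rewrite mulrDr; apply: (AD); first exact: AM.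
by rewrite mulrACA; exact: AM.
Qed.

(** Otherwise the ideal generated by [P] and [u] is proper, and a prime ideal
    above it makes a chain of length 1 with [P]. *)
Lemma krull_dim0_unit I P u :
  krull_dim I 0 -> Spec I P -> ~ P u -> exists v, P (v * u - 1).
Proof.
move=> [_ dimI] [Pp IP] nPu; apply: contrapT => nv.
have /is_primeP[idP P1 _] := Pp.
have [||||Q [Qp PQ _]] := @prime_avoiding (adjoin P u) [set 1].
- exact: is_ideal_adjoin.
- by [].
- by move=> x y -> ->; rewrite mulr1.
- move=> _ [a [r [Pa ->]]] E; apply: nv; exists r.
  by rewrite -E opprD addrCA subrr addr0 -mulN1r; case: idP => _ _; apply.
have PQ' : P `<=` Q by move=> x /(@sub_adjoin P u)/PQ.
suff /dimI : prime_chain I 1 by [].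
(* The chain P, Q of two distinct primes has length 1. *)
exists (fun i : 'I_2 => if i == 0 :> nat then P else Q); split.
  by case=> -[|[|//]] i; split=> //= x /IP; exact: PQ'.
case=> -[|[|//]] i; case=> -[|[|//]] j //= _.
rewrite classical_sets.properEneq; split=> //; apply/eqP => E; apply: nPu.
by rewrite E; apply/PQ/mem_adjoin.
Qed.

End Primes.

Lemma prime_preimage (A B : comNzRingType) (phi : {rmorphism A -> B}) (q : set B) :
  is_prime q -> is_prime (phi @^-1` q).
Proof.
move=> /is_primeP[[q0 qD qM] q1 qp]; apply/is_primeP; split.
- split => [|x y px py|a x px] /=; first by rewrite rmorph0.
    by rewrite rmorphD; exact: qD.
  by rewrite rmorphM; exact: qM.
- by rewrite /= rmorph1.
- by move=> u v; rewrite /= rmorphM => /qp.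
Qed.

Lemma injective_ord_of_infinite (T : Type) (A : set T) k :
  infinite_set A -> exists c : 'I_k -> T, injective c /\ forall i, A (c i).
Proof.
move=> /infiniteP/card_leP/unsquash g.
pose h (i : nat) : set_type [set: nat] := SigSub (mem_set (I : [set: nat] i)).
exists (fun i => \val (g (h i))); split; last by move=> i; apply/set_mem/valP.
move=> i j /val_inj/(inj (mem_set I) (mem_set I))/(congr1 val) /= E.
exact: val_inj.
Qed.

(** A form of Zariski's lemma, by counting. If [y] were transcendental modulo
    [I], some prime ideal [P] above [I] would contain no nonzero polynomial in
    [y]. Every [y - c] is then invertible modulo [P]. As the field is
    uncountable, infinitely many of these inverses have representatives of
    degree below a common bound, so there is a linear relation between finitely many
    1 / (y - c); clearing denominators gives a nonzero polynomial in [y] that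
    lies in [P]. *)
Lemma krull_dim0_algebraic (k : fieldType) n (I : set {mpoly k[n]})
    (y : {mpoly k[n]}) :
  ~ countable [set: k] -> is_ideal I -> krull_dim I 0 ->
  exists2 p : {poly k}, p != 0 & I (map_poly (@mpolyC n k) p).[y].
Proof.
move=> uncK idI dimI; apply: contrapT => nalg.
pose ev (p : {poly k}) := (map_poly (@mpolyC n k) p).[y].
have evM p q : ev (p * q) = ev p * ev q by rewrite /ev rmorphM hornerM.
have evXC c : ev ('X - c%:P) = y - c%:MP.
  by rewrite /ev rmorphB /= map_polyX map_polyC hornerXsubC.
have [||x1 x2|x Ix|P [Pp IP PS]] :=
  @prime_avoiding _ I [set x | exists2 p, p != 0 & x = ev p].
- exact: idI.
- by exists 1; rewrite ?oner_neq0 // /ev rmorph1 hornerC.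
- by move=> [p p0 ->] [q q0 ->]; exists (p * q); rewrite ?mulf_neq0 // evM.
- by move=> [p p0 E]; apply: nalg; exists p => //; rewrite -[X in I X]E.
have /is_primeP[[P0 PD PM] P1 Pmul] := Pp.
have /choice[q qP] : forall c, exists v, P (v * (y - c%:MP) - 1).
  move=> c; apply: (krull_dim0_unit dimI) => // H.
  by apply: (PS _ H); exists ('X - c%:P); rewrite ?polyXsubC_eq0 ?evXC.
(* Otherwise the field would be a countable union of finite sets. *)
have [N Ninf] : exists N, infinite_set [set c | (msize (q c) <= N)%N].
  apply: contrapT => H; apply: uncK.
  rewrite (_ : setT = \bigcup_N [set c | (msize (q c) <= N)%N]); last first.
    by apply/seteqP; split=> // c _; exists (msize (q c)) => /=.
  apply: bigcup_countable => // i _; apply: finite_set_countable.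
  by apply: contrapT => H'; apply: H; exists i.
(* M + 1 polynomials with only M possible monomials are linearly dependent. *)
pose M := #|{: 'X_{1..n < N}}|.
have [c [cinj cN]] := @injective_ord_of_infinite k _ M.+1 Ninf.
pose X : 'M[k]_(M.+1, M) :=
  \matrix_(i, j) (q (c i))@_(bmnm (@enum_val 'X_{1..n < N} predT j)).
have : kermx X != 0.
  rewrite kermx_eq0 /row_free; apply/eqP => H.
  by have := rank_leq_col X; rewrite H ltnn.
move=> /rowV0Pn[v /sub_kermxP vX v0].
have qv : \sum_i v 0 i *: q (c i) = 0.
  apply/mpolyP => m; rewrite mcoeff0 raddf_sum /=.
  have [mN|Nm] := ltnP (mdeg m) N.
    have /rowP/(_ (enum_rank (BMultinom mN))) := vX; rewrite !mxE => vXm.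
    rewrite -[RHS]vXm.
    by apply: eq_bigr => i _; rewrite mcoeffZ !mxE enum_rankK.
  apply: big1 => i _; rewrite mcoeffZ memN_msupp_eq0 ?mulr0 //.
  by apply/negP => /msize_mdeg_lt; rewrite ltnNge (leq_trans (cN i)).
(* The relation between the 1 / (y - c_i), multiplied by all the y - c_l. *)
pose g : {poly k} := \sum_i (v 0 i)%:P * \prod_(l | l != i) ('X - (c l)%:P).
have gE x : g.[x] = \sum_i v 0 i * \prod_(l | l != i) (x - c l).
  rewrite /g horner_sum; apply: eq_bigr => i _; rewrite hornerM hornerC horner_prod.
  by under eq_bigr do rewrite hornerXsubC.
have g0 : g != 0.
  have [i vi] : exists i, v 0 i != 0.
    apply: contrapT => H; move/eqP: v0; apply; apply/rowP => i; rewrite mxE.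
    by apply/eqP/negP => /negP vi; apply: H; exists i.
  apply/eqP => gg; have /eqP := gE (c i); rewrite {1}gg horner0 eq_sym.
  rewrite (bigD1 i) //= [X in _ + X]big1 ?addr0 => [|j ji]; last first.
    by rewrite (bigD1 i) 1?eq_sym //= subrr mul0r mulr0.
  apply/negP; rewrite mulf_neq0 //; apply/prodf_neq0 => l li.
  by rewrite subr_eq0; apply: contraNneq li => /cinj ->.
apply: (PS (ev g)); last by exists g.
have evZ a p : ev (a%:P * p) = a%:MP * ev p.
  by rewrite evM /ev map_polyC hornerC.
have evS : ev g = \sum_i (v 0 i)%:MP * ev (\prod_(l | l != i) ('X - (c l)%:P)).
  by rewrite /ev /g rmorph_sum horner_sum; apply: eq_bigr => i _; exact: evZ.
(* The combination of the q (c_i) vanishes, so ev g is the error made in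
   treating each q (c_i) as an inverse of y - c_i, an element of P. *)
have E : ev g = - \sum_i ((v 0 i)%:MP * ev (\prod_(l | l != i) ('X - (c l)%:P)))
     * (q (c i) * (y - (c i)%:MP) - 1).
  apply/eqP; rewrite -addr_eq0 evS -big_split /=; apply/eqP.
  transitivity (\sum_i (v 0 i *: q (c i)) * ev (\prod_l ('X - (c l)%:P))).
    apply: eq_bigr => i _; rewrite mulrBr mulr1 addrCA subrr addr0.
    rewrite [X in _ = _ * ev X](bigD1 i) //= evM evXC -mul_mpolyC; ring.
  by rewrite -mulr_suml qv mul0r.
rewrite E -[X in P X]mulN1r; apply: (PM); apply: is_ideal_sum => // i.
by apply: PM; exact: qP.
Qed.

(** * Denominators in a fraction field *)

Section Denominators.
Variable A : idomainType.
Implicit Types (p : set A) (z : {fraction A}).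

Definition regular_at p z : Prop :=
  exists a h, ~ p h /\ h%:F * z = a%:F.

Lemma is_prime0 : is_prime [set 0 : A].
Proof.
apply/is_primeP; split.
- split; first by [].
    by move=> x y -> ->; rewrite addr0.
  by move=> a x ->; rewrite mulr0.
- by apply/eqP; exact: oner_neq0.
- by move=> u v /eqP; rewrite mulf_eq0 => /orP[]/eqP; [left|right].
Qed.

Lemma prime_kernel (B : comNzRingType) (f : {rmorphism B -> A}) :
  is_prime (f @^-1` [set 0]).
Proof. exact: (@prime_preimage B A f [set 0] is_prime0). Qed.

Lemma regular_at0 z : regular_at [set 0] z.
Proof.
elim/quotW: z => x; exists (\n_x), (\d_x); split.
  by apply/eqP; exact: denom_ratioP.
rewrite !piE; apply/eqmodP => /=.
rewrite FracField.equivfE /FracField.mulf.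
by rewrite !numden_Ratio ?mul1r ?oner_eq0 ?denom_ratioP ?mulr1 //.
Qed.

(** Denominators are multiplied, and a product stays outside the prime
    ideal. *)
Lemma regular_common p (zs : seq {fraction A}) : is_prime p ->
  (forall z, z \in zs -> regular_at p z) ->
  exists h, ~ p h /\ forall z, z \in zs -> exists a, h%:F * z = a%:F.
Proof.
move=> /is_primeP[_ p1 pM]; elim: zs => [|z zs IH] reg.
  by exists 1.
have [|h [ph hP]] := IH.
  by move=> w wzs; apply: reg; rewrite inE wzs orbT.
have [|a [g [pg ga]]] := reg z; first exact: mem_head.
exists (h * g); split; first by move=> /pM[].
move=> w; rewrite inE => /orP[/eqP ->|/hP[b hb]].
  by exists (h * a); rewrite !rmorphM -mulrA ga.
by exists (g * b); rewrite !rmorphM /= -hb; ring.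
Qed.

Lemma regular_atC p a : is_prime p -> regular_at p a%:F.
Proof. by move=> /is_primeP[_ p1 _]; exists a, 1; rewrite tofrac1 mul1r. Qed.

Lemma regular_atD p z w : is_prime p ->
  regular_at p z -> regular_at p w -> regular_at p (z + w).
Proof.
move=> /is_primeP[_ _ pM] [a [g [pg ga]]] [b [h [ph hb]]].
exists (h * a + g * b), (g * h); split; first by move=> /pM[].
by rewrite rmorphD !rmorphM /= -ga -hb; ring.
Qed.

Lemma regular_atM p z w : is_prime p ->
  regular_at p z -> regular_at p w -> regular_at p (z * w).
Proof.
move=> /is_primeP[_ _ pM] [a [g [pg ga]]] [b [h [ph hb]]].
exists (a * b), (g * h); split; first by move=> /pM[].
by rewrite !rmorphM /= -ga -hb; ring.
Qed.

Lemma map_mpoly_inj (n : nat) (R S : nzRingType) (f : {rmorphism R -> S}) :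
  injective f -> injective (@map_mpoly n R S f).
Proof.
move=> finj p q /mpolyP pq; apply/mpolyP => m; apply: finj.
by rewrite -!mcoeff_map_mpoly.
Qed.

(** Multiply the relation by a common denominator of all the coefficients
    involved. *)
Lemma algebraic_clear_denominators n k (F : 'I_k -> {mpoly A[n]})
    (y : {mpoly A[n]}) (p : {poly {fraction A}}) : p != 0 ->
  ideal_gen (fun i => map_mpoly (@tofrac A) (F i))
    (map_poly (@mpolyC n {fraction A}) p).[map_mpoly (@tofrac A) y] ->
  exists2 P : {poly A}, P != 0 &
    ideal_gen F (map_poly (@mpolyC n A) P).[y].
Proof.
move=> p0 [c pc].
pose zs := p ++ flatten [seq [seq (c i)@_m | m <- msupp (c i)] | i <- enum 'I_k].
have [|h [/eqP h0 hP]] := @regular_common _ zs is_prime0.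
  by move=> z _; exact: regular_at0.
have /choice[num numP] : forall z, exists a, z \in zs -> h%:F * z = a%:F.
  move=> z; have [/hP[a aP]|] := boolP (z \in zs); first by exists a.
  by exists 0.
pose P := \poly_(i < size p) num p`_i.
have PE : map_poly (@tofrac A) P = h%:F *: p.
  apply/polyP => i; rewrite coef_map coef_poly coefZ.
  case: ltnP => ip; last by rewrite nth_default // mulr0 raddf0.
  by rewrite [LHS]/= -numP // mem_cat mem_nth.
pose C i := \sum_(m <- msupp (c i)) num (c i)@_m *: 'X_[m].
have CE i : map_mpoly (@tofrac A) (C i) = h%:F%:MP * c i.
  rewrite /C rmorph_sum [X in _ = _ * X]mpolyE mulr_sumr /= big_seq [RHS]big_seq.
  apply: eq_bigr => m mc; rewrite map_mpolyZ map_mpolyX mul_mpolyC scalerA.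
  rewrite [X in X *: _]/= -numP // mem_cat; apply/orP; right.
  by apply/flatten_mapP; exists i; rewrite ?mem_enum //; exact: map_f.
exists P.
  apply/eqP => P0; move/eqP: PE; rewrite P0 rmorph0 eq_sym scaler_eq0.
  by rewrite tofrac_eq0 (negPf h0) (negPf p0).
exists C; apply: (@map_mpoly_inj n A _ (@tofrac A)).
  by move=> a b /eqP; rewrite tofrac_eq => /eqP.
rewrite rmorph_sum /=.
under eq_bigr do rewrite rmorphM /= CE -mulrA.
rewrite -mulr_sumr -pc -horner_map /=.
have -> : map_poly (map_mpoly (@tofrac A)) (map_poly (@mpolyC n A) P) =
    map_poly (@mpolyC n _) (map_poly (@tofrac A) P).
  by apply/polyP => i; rewrite !coef_map /= map_mpolyC.
by rewrite PE map_polyZ hornerZ.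
Qed.
End Denominators.

(** * Fractions and sections on an open set of parameters *)

(** Addition of representatives of fractions; [section_add] is its pointwise
    extension. *)
Definition frac_add (B : comNzRingType) (x y : B * B) : B * B :=
  (x.1 * y.2 + y.1 * x.2, x.2 * y.2).

Section Fractions.
Variables (B : comNzRingType) (J q : set B).
Hypotheses (idJ : is_ideal J) (primeq : is_prime q).

Let qM u v : ~ q u -> ~ q v -> ~ q (u * v).
Proof. by have /is_primeP[_ _ qM] := primeq => qu qv /qM[]. Qed.

Let q1 : ~ q 1. Proof. by have /is_primeP[] := primeq. Qed.

Lemma frac_eqxx (s : B * B) : frac_eq J q s s.
Proof. by exists 1 => //; rewrite subrr mulr0; case: idJ. Qed.

Lemma frac_eq_sym (s t : B * B) : frac_eq J q s t -> frac_eq J q t s.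
Proof.
move=> [u qu Ju]; exists u => //; rewrite -opprB mulrN -mulN1r.
by case: idJ => _ _; apply.
Qed.

Lemma frac_eq_trans t s r :
  ~ q t.2 -> frac_eq J q s t -> frac_eq J q t r -> frac_eq J q s r.
Proof.
move=> qt [u qu Ju] [v qv Jv]; exists (t.2 * (u * v)); first by do 2 apply: qM => //.
rewrite (_ : _ * _ = r.2 * v * (u * (s.1 * t.2 - t.1 * s.2)) +
  s.2 * u * (v * (t.1 * r.2 - r.1 * t.2))); last by ring.
by case: idJ => _ JD JM; apply: JD; exact: JM.
Qed.

(** The iterated sum of representatives has the product of all denominators as
    denominator; this lemma replaces it by any common one, so that equalities
    of sums of fractions reduce to equalities of sums in [B]. *)
Lemma frac_eq_sum (T : eqType) (L : seq T) (s : T -> B * B) (a : T -> B) (g : B) :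
  (forall t, t \in L -> ~ q (s t).2) ->
  (forall t, t \in L -> frac_eq J q (s t) (a t, g)) ->
  ~ q (\big[@frac_add B/(0, 1)]_(t <- L) s t).2 /\
  frac_eq J q (\big[@frac_add B/(0, 1)]_(t <- L) s t) (\sum_(t <- L) a t, g).
Proof.
elim: L => [|t L IH] qs sa.
  rewrite !big_nil; split=> //; exists 1 => //.
  by rewrite /= mulr1 mul0r subrr mulr0; case: idJ.
have [||qL [u qu Ju]] := IH; [by move=> x xL; apply: qs; rewrite inE xL orbT
  |by move=> x xL; apply: sa; rewrite inE xL orbT|].
have [v qv Jv] := sa t (mem_head _ _).
rewrite !big_cons; split; first by apply: qM => //; exact/qs/mem_head.
exists (u * v); first exact: qM.
set S := \big[_/_]_(_ <- _) _ in Ju qL *; move: Ju Jv => /=.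
set X := \sum_(_ <- _) _ => Ju Jv.
rewrite (_ : _ * _ = u * S.2 * (v * ((s t).1 * g - a t * (s t).2)) +
   v * (s t).2 * (u * (S.1 * g - X * S.2))); last by ring.
by case: idJ => _ JD JM; apply: JD; exact: JM.
Qed.

Lemma frac_common_denominator (T : eqType) (L : seq T) (s : T -> B * B) :
  (forall t, t \in L -> ~ q (s t).2) ->
  exists (a : T -> B) (g : B),
    ~ q g /\ forall t, t \in L -> frac_eq J q (s t) (a t, g).
Proof.
move=> qs; suff [g [qg gP]] : exists g, ~ q g /\
    forall t, exists a, t \in L -> frac_eq J q (s t) (a, g).
  by have [a aP] := choice gP; exists a, g.
elim: L qs => [|t L IH] qs; first by exists 1; split=> // t; exists 0.
have [|g [qg gP]] := IH; first by move=> x xL; apply: qs; rewrite inE xL orbT.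
exists ((s t).2 * g); split; first by apply: qM => //; exact/qs/mem_head.
move=> x; have [->|xt] := eqVneq x t.
  exists ((s t).1 * g) => _; exists 1 => //.
  rewrite (_ : _ * _ = 0); first by case: idJ.
  by rewrite /=; ring.
have [a aP] := gP x; exists ((s t).2 * a); rewrite inE (negPf xt) /=.
move=> /aP[u qu Ju]; exists u => //; move: Ju => /= Ju.
rewrite (_ : _ * _ = (s t).2 * (u * ((s x).1 * g - a * (s x).2))); last by ring.
by case: idJ => _ _; apply.
Qed.

End Fractions.

Section Germs.
Variables (A : idomainType) (U : set (set A)).
Hypothesis openU : zariski_open [set 0] U.
Implicit Types (p : set A) (z : {fraction A}) (c : set A -> A * A).

Lemma open_prime p : U p -> is_prime p.
Proof. by case: openU => E -> [[]]. Qed.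

(** The zero ideal is the generic point: it lies in every nonempty open set. *)
Lemma open_generic (V : set (set A)) p : zariski_open [set 0] V -> V p -> V [set 0].
Proof.
move=> [E ->] [[/is_primeP[[p0 _ _] _ _] _] Ep]; split.
  by split=> //; exact: is_prime0.
by move=> E0; apply: Ep => x /E0 ->.
Qed.

Lemma open_basic (V : set (set A)) (h : A) :
  zariski_open [set 0] V -> zariski_open [set 0] [set p | V p /\ ~ p h].
Proof.
(* A prime ideal contains the product set E h iff it contains E or h. *)
move=> [E ->]; exists [set x | exists2 e, E e & x = e * h].
apply/seteqP; split=> p /= [].
  move=> [sp Ep] ph; split=> // H; apply: Ep => e Ee.
  by have [/is_primeP[_ _ pM] _] := sp; case: (pM e h) => //; apply: H; exists e.
move=> sp Ep; have [/is_primeP[[_ _ pM] _ _] _] := sp.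
split; last by move=> ph; apply: Ep => _ [e Ee ->]; exact: pM.
by split=> // H; apply: Ep => _ [e /H pe ->]; rewrite mulrC; exact: pM.
Qed.

(** The value of a section at the generic point, as an element of the fraction
    field. *)
Definition germ c : {fraction A} := (c [set 0]).1%:F / (c [set 0]).2%:F.

Lemma frac_eq0 p s t : is_prime p ->
  frac_eq [set 0] p s t -> s.1 * t.2 = t.1 * s.2.
Proof.
move=> /is_primeP[[p0 _ _] _ _] [u pu /eqP].
rewrite mulf_eq0 => /orP[/eqP u0|]; first by rewrite u0 in pu.
by rewrite subr_eq0 => /eqP.
Qed.

(** On an integral scheme a section is determined by its germ at the generic
    point: near [p] the section is one fraction, which the generic point sees
    as well. *)
Lemma germP c p : is_section [set 0] U c -> U p ->
  ~ p (c p).2 /\ (c p).2%:F * germ c = (c p).1%:F.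
Proof.
move=> cU Up; have [V [a [g [oV Vp VU Vc]]]] := cU p Up.
have [p_g p_c /(frac_eq0 (open_prime Up)) /= cp] := Vc p Vp.
have [/eqP g0 /eqP c0 /(frac_eq0 (is_prime0 A)) /= c0E] := Vc _ (open_generic oV Vp).
split=> //; rewrite /germ.
have gF : g%:F != 0 by rewrite tofrac_eq0.
have cF : (c [set 0]).2%:F != 0 by rewrite tofrac_eq0.
(* The fraction a / g that represents c near p also represents it at 0. *)
have E0 : (c [set 0]).1%:F / (c [set 0]).2%:F = a%:F / g%:F.
  by apply/eqP; rewrite eqr_div // -!tofracM c0E.
by rewrite E0 mulrA -tofracM [_ * a]mulrC -cp tofracM mulfK.
Qed.

(** The section with germ [z]: where [z] is regular, some representative of it
    whose denominator does not vanish. *)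
Definition section_of z p : A * A :=
  xget (0, 1) [set s : A * A | ~ p s.2 /\ s.2%:F * z = s.1%:F].

Lemma section_ofP z p : regular_at p z ->
  ~ p (section_of z p).2 /\ (section_of z p).2%:F * z = (section_of z p).1%:F.
Proof.
move=> [a [h ah]]; rewrite /section_of; case: xgetP => [s _ //|].
by move=> /(_ (a, h)).
Qed.

Lemma section_of_is_section z : (forall p, U p -> regular_at p z) ->
  is_section [set 0] U (section_of z).
Proof.
move=> zU p Up; have [a [h [ph hz]]] := zU p Up.
exists [set p | U p /\ ~ p h], a, h; split=> //; first exact: open_basic.
  by move=> ? [].
move=> r [Ur rh]; have [rs rz] := section_ofP (zU r Ur).
split=> //; exists 1; first by have /is_primeP[] := open_prime Ur.
rewrite mul1r /=; apply/eqP; rewrite subr_eq0 -tofrac_eq !tofracM.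
by rewrite -rz -hz; apply/eqP; ring.
Qed.

End Germs.

(** * Coordinates in a free module of sections *)

Section Coordinates.
Variables (A : idomainType) (B : comNzRingType) (phi : {rmorphism A -> B}).
Variables (U : set (set A)) (J : set B).
Hypotheses (openU : zariski_open [set 0] U) (U0 : U [set 0]) (idJ : is_ideal J).
Let W : set (set B) := [set q | Spec J q /\ U (phi @^-1` q)].
Variables (T : choiceType) (b : T -> set B -> B * B).
Hypothesis sec_b : forall t, is_section J W (b t).
Hypothesis span_b : forall s, is_section J W s ->
  exists (k : nat) (t : 'I_k -> T) (c : 'I_k -> set A -> A * A),
    (forall i, is_section [set 0] U (c i)) /\
    section_eq J W s (\big[@section_add B/@section0 B]_(i < k)
                        section_act phi (c i) (b (t i))).
Hypothesis indep_b : forall (k : nat) (t : 'I_k -> T) (c : 'I_k -> set A -> A * A),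
  injective t -> (forall i, is_section [set 0] U (c i)) ->
  section_eq J W (\big[@section_add B/@section0 B]_(i < k)
                    section_act phi (c i) (b (t i))) (@section0 B) ->
  forall i, section_eq [set 0] U (c i) (@section0 A).
Implicit Types (e : T -> {fraction A}) (L : seq T).

Definition basis_term e (q : set B) (t : T) : B * B :=
  section_act phi (section_of (e t)) (b t) q.

(** The combination of the basis elements in [L] with coefficients [e t], at
    the point [q]. Coefficients are taken in the fraction field, where they
    form a ring, and not as sections, which are only representatives. *)
Definition combination e L q := \big[@frac_add B/(0, 1)]_(t <- L) basis_term e q t.

Lemma big_section_add (I : Type) (r : seq I) (s : I -> set B -> B * B) q :
  (\big[@section_add B/@section0 B]_(i <- r) s i) q =
  \big[@frac_add B/(0, 1)]_(i <- r) s i q.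
Proof. by elim/big_rec2: _ => // i x y _ <-. Qed.

Let Wprime q : W q -> is_prime q. Proof. by move=> [[]]. Qed.
Let WJ q : W q -> J `<=` q. Proof. by move=> [[]]. Qed.
Let WU q : W q -> is_prime (phi @^-1` q).
Proof. by move=> [_ /open_prime]; exact. Qed.

Lemma basis_den t q : W q -> ~ q (b t q).2.
Proof. by move=> Wq; have [V [x [g [_ Vq _ Vb]]]] := sec_b t Wq; case: (Vb q Vq). Qed.

Definition regular_fun e := forall t p, U p -> regular_at p (e t).

(** A common denominator [h] downstairs and a common denominator [g] upstairs
    give the common denominator [phi h * g] of the products. *)
Lemma act_frac_eq q (c : A * A) (s : B * B) (a h : A) (r g : B) :
  W q -> ~ q (phi c.2) -> ~ q s.2 ->
  c.1 * h = a * c.2 -> frac_eq J q s (r, g) ->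
  frac_eq J q (phi c.1 * s.1, phi c.2 * s.2) (phi a * r, phi h * g).
Proof.
move=> Wq qc qs ca [u qu Ju]; exists u => //=.
have /(congr1 phi) := ca; rewrite !rmorphM /= => phica.
rewrite (_ : _ * _ = phi a * phi c.2 * (u * (s.1 * g - r * s.2))).
  by case: idJ => _ _; apply.
by rewrite -phica; ring: phica.
Qed.

Lemma basis_term_den e q t : regular_fun e -> W q -> ~ q (basis_term e q t).2.
Proof.
move=> re Wq; have /is_primeP[_ _ qM] := Wprime Wq; move=> /qM[].
  by have [] := section_ofP (re t _ Wq.2).
exact: basis_den.
Qed.

Lemma combination_frac_eq e L q h (a : T -> A) g (r : T -> B) :
  regular_fun e -> W q ->
  (forall t, t \in L -> h%:F * e t = (a t)%:F) ->
  (forall t, t \in L -> frac_eq J q (b t q) (r t, g)) ->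
  ~ q (combination e L q).2 /\
  frac_eq J q (combination e L q) (\sum_(t <- L) phi (a t) * r t, phi h * g).
Proof.
move=> re Wq ha rg; apply: frac_eq_sum => //; [exact: Wprime|..].
  by move=> t tL; exact: basis_term_den.
move=> t tL; have [sp se] := section_ofP (re t _ Wq.2).
apply: act_frac_eq => //; [exact: basis_den| |exact: rg].
apply/eqP; rewrite -tofrac_eq !tofracM -se -ha //; apply/eqP; ring.
Qed.

(** [e] is the coordinate function of the global section [x / 1]. Combinations
    over all finite lists containing the support are considered at once, so
    that two elements with different supports can be compared. *)
Definition is_coord (x : B) e : Prop :=
  regular_fun e /\ exists L0, (forall t, t \notin L0 -> e t = 0) /\
    forall L q, uniq L -> {subset L0 <= L} -> W q ->
      frac_eq J q (x, 1) (combination e L q).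

Lemma regular_seq e L q : regular_fun e -> W q ->
  forall t, t \in [seq e t | t <- L] -> regular_at (phi @^-1` q) t.
Proof. by move=> re [_ Uq] _ /mapP[t _ ->]; exact: re. Qed.

Lemma common_numerators (h : A) (zs : seq {fraction A}) e L :
  (forall z, z \in zs -> exists a, h%:F * z = a%:F) ->
  {subset [seq e t | t <- L] <= zs} ->
  exists a : T -> A, forall t, t \in L -> h%:F * e t = (a t)%:F.
Proof.
move=> hP Lzs; suff /choice[a aP] : forall t, exists a, t \in L -> h%:F * e t = a%:F.
  by exists a.
move=> t; have [tL|] := boolP (t \in L); last by exists 0.
by have [|a aP] := hP (e t); [exact/Lzs/map_f|exists a].
Qed.

Lemma open_preimage : zariski_open J W.
Proof.
have [E UE] := openU; exists (phi @` E); apply/seteqP; split=> q.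
  move=> [sq]; rewrite UE => -[_ Eq]; split=> // H; apply: Eq => e Ee.
  by apply: H; exists e.
move=> [sq Eq]; split=> //; rewrite UE; split.
  split; first by apply: prime_preimage; case: sq.
  by have /is_primeP[[q0 _ _] _ _] := sq.1; move=> _ ->; rewrite /= rmorph0.
by move=> H; apply: Eq => _ [e Ee <-]; exact: H.
Qed.

(** Spanning yields finitely many pairs of a coefficient and a basis element,
    with possible repetitions of the latter; the coordinate at a basis element
    is the sum of the germs of its coefficients. *)
Lemma coord_exists x : exists e, is_coord x e.
Proof.
have [|k [t [c [secc xc]]]] := @span_b (fun=> (x, 1)).
  move=> q Wq; exists W, x, 1; split=> //.
    exact: open_preimage.
  move=> q' /Wprime primeq'; have /is_primeP[_ q1 _] := primeq'; split=> //.
  exact: (frac_eqxx idJ primeq').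
(* The t i may repeat: collect the coefficients of each basis element. *)
pose e y := \sum_(i | t i == y) germ (c i).
have regc i p : U p -> regular_at p (germ (c i)).
  by move=> Up; have [pc cE] := germP openU (secc i) Up; exists (c i p).1, (c i p).2.
have re : regular_fun e.
  move=> y p Up; rewrite /e; elim/big_ind: _ => [|z w|i _]; last exact: regc.
    by rewrite -tofrac0; exact/regular_atC/(open_prime openU).
  exact/regular_atD/(open_prime openU).
exists e; split=> //; exists (codom t); split.
  move=> y yt; rewrite /e big_pred0 // => i; apply/negbTE.
  by apply: contra yt => /eqP <-; exact: codom_f.
move=> L q uL tL Wq.
have primeq := Wprime Wq.
have [r [g [qg rg]]] := @frac_common_denominator _ _ _ idJ primeq _ L (b^~ q)
  (fun t _ => basis_den Wq).
have [h [ph hP]] := @regular_common _ _ [seq germ (c i) | i <- enum 'I_k] (WU Wq)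
  (fun z => ltac:(by move=> /mapP[i _ ->]; exact: regc Wq.2)).
have /choice[a aP] : forall i, exists a, h%:F * germ (c i) = a%:F.
  by move=> i; apply/hP/map_f; rewrite mem_enum.
have regc' i : ~ q (phi (c i (phi @^-1` q)).2) by have [] := germP openU (secc i) Wq.2.
have [||den1 eq1] := @frac_eq_sum _ _ _ idJ primeq _ (index_enum 'I_k)
  (fun i => section_act phi (c i) (b (t i)) q) (fun i => phi (a i) * r (t i)) (phi h * g).
- move=> i _ /=; have /is_primeP[_ _ qM] := primeq; move=> /qM[]; first exact: regc'.
  exact: basis_den.
- move=> i _; apply: act_frac_eq => //; [exact: basis_den| |exact/rg/tL/codom_f].
  have [_ ci] := germP openU (secc i) Wq.2.
  by apply/eqP; rewrite -tofrac_eq !tofracM -ci -aP; apply/eqP; ring.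
have [|den2 eq2] := @combination_frac_eq e L q h
  (fun y => \sum_(i | t i == y) a i) g r re Wq _ rg.
  by move=> y yL; rewrite /e mulr_sumr rmorph_sum; apply: eq_bigr => i _; exact: aP.
have qhg : ~ q (phi h * g) by have /is_primeP[_ _ qM] := primeq; move=> /qM[].
apply: (frac_eq_trans idJ primeq den1); first by have := xc q Wq; rewrite big_section_add.
apply: (frac_eq_trans idJ primeq _ eq1) => //.
rewrite (_ : \sum_(i <- _) _ = \sum_(y <- L) phi (\sum_(i | t i == y) a i) * r y).
  exact: frac_eq_sym.
(* Regroup the sum over i by the value of t i. *)
under [RHS]eq_bigr do rewrite rmorph_sum mulr_suml big_mkcond.
rewrite exchange_big /=; apply: eq_bigr => i _.
rewrite (bigD1_seq (t i)) ?tL ?codom_f //= eqxx big1 ?addr0 // => y yt.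
by rewrite eq_sym (negPf yt).
Qed.

Lemma coord_linear l x y e f : is_coord x e -> is_coord y f ->
  is_coord (phi l * x + y) (fun t => l%:F * e t + f t).
Proof.
move=> [re [L0 [L0e xe]]] [rf [L1 [L1f yf]]].
have ref : regular_fun (fun t => l%:F * e t + f t).
  move=> t p Up; have pp := open_prime openU Up.
  apply: regular_atD => //; last exact: rf.
  by apply: regular_atM => //; [exact: regular_atC|exact: re].
split=> //; exists (L0 ++ L1); split.
  move=> t; rewrite mem_cat negb_or => /andP[/L0e -> /L1f ->].
  by rewrite mulr0 addr0.
move=> L q uL L01 Wq; have primeq := Wprime Wq; have /is_primeP[_ q1 qM] := primeq.
have [r [g [qg rg]]] := @frac_common_denominator _ _ _ idJ primeq _ L (b^~ q)
  (fun t _ => basis_den Wq).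
have [|h [ph hP]] :=
  @regular_common _ _ ([seq e t | t <- L] ++ [seq f t | t <- L]) (WU Wq).
  by move=> z; rewrite mem_cat => /orP[] /regular_seq; exact.
have [|a aP] := @common_numerators h _ e L hP.
  by move=> z zL; rewrite mem_cat zL.
have [|d dP] := @common_numerators h _ f L hP.
  by move=> z zL; rewrite mem_cat zL orbT.
have [ce cea] := combination_frac_eq re Wq aP rg.
have [cf cfa] := combination_frac_eq rf Wq dP rg.
have [|cef cefa] := @combination_frac_eq _ L q h (fun t => l * a t + d t) g r ref Wq _ rg.
  by move=> t tL; rewrite mulrDr mulrCA aP // dP // tofracD tofracM.
have qhg : ~ q (phi h * g) by move=> /qM[].
have sub0 : {subset L0 <= L} by move=> t tL; apply: L01; rewrite mem_cat tL.
have sub1 : {subset L1 <= L} by move=> t tL; apply: L01; rewrite mem_cat tL orbT.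
have [u qu Ju] := frac_eq_trans idJ primeq ce (xe L q uL sub0 Wq) cea.
have [v qv Jv] := frac_eq_trans idJ primeq cf (yf L q uL sub1 Wq) cfa.
apply: (frac_eq_trans idJ primeq _ _ (frac_eq_sym idJ cefa)) => //.
exists (u * v); first by move=> /qM[].
have -> : \sum_(t <- L) phi (l * a t + d t) * r t =
    phi l * \sum_(t <- L) phi (a t) * r t + \sum_(t <- L) phi (d t) * r t.
  rewrite mulr_sumr -big_split; apply: eq_bigr => t _ /=.
  by rewrite rmorphD rmorphM mulrDl mulrA.
move: Ju Jv => /=; set X := \sum_(t <- L) _; set Y := \sum_(t <- L) _ => Ju Jv.
rewrite (_ : _ * _ = v * phi l * (u * (x * (phi h * g) - X * 1)) +
  u * (v * (y * (phi h * g) - Y * 1))); last by ring.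
by case: idJ => _ JD JM; apply: JD; exact: JM.
Qed.

Lemma combination0_frac_eq L q : W q ->
  exists g, [/\ ~ q g, ~ q (combination (fun=> 0) L q).2 &
    frac_eq J q (combination (fun=> 0) L q) (0, g)].
Proof.
move=> Wq; have primeq := Wprime Wq; have /is_primeP[_ q1 qM] := primeq.
have [r [g [qg rg]]] := @frac_common_denominator _ _ _ idJ primeq _ L (b^~ q)
  (fun t _ => basis_den Wq).
have r0 : regular_fun (fun=> 0).
  by move=> t p Up; rewrite -tofrac0; exact/regular_atC/(open_prime openU).
have [|c0 c0E] := @combination_frac_eq _ L q 1 (fun=> 0) g r r0 Wq _ rg.
  by move=> t _; rewrite mulr0 tofrac0.
exists g; split=> //; move: c0E; rewrite rmorph1 mul1r big1 // => t _.
by rewrite rmorph0 mul0r.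
Qed.

Lemma is_coord_ideal x : J x -> is_coord x (fun=> 0).
Proof.
move=> Jx; split.
  by move=> t p Up; rewrite -tofrac0; exact/regular_atC/(open_prime openU).
exists [::]; split=> // L q _ _ Wq; have primeq := Wprime Wq.
have /is_primeP[_ q1 qM] := primeq.
have [g [qg _ c0]] := combination0_frac_eq L Wq.
apply: (frac_eq_trans idJ primeq _ _ (frac_eq_sym idJ c0)) => //.
exists 1 => //=; rewrite mul1r mul0r subr0 mulrC.
by case: idJ => _ _; apply.
Qed.

(** Equality of fractions at [q] holds after multiplication by an element
    outside [q], which gives membership in [q] itself. *)
Lemma is_coord0_vanish x q : is_coord x (fun=> 0) -> W q -> q x.
Proof.
move=> [_ [L0 [_ xL]]] Wq; have primeq := Wprime Wq.
have /is_primeP[_ q1 qM] := primeq.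
have [g [qg c0 c0E]] := combination0_frac_eq (undup L0) Wq.
have sub : {subset L0 <= undup L0} by move=> t; rewrite mem_undup.
have [u qu] := frac_eq_trans idJ primeq c0 (xL _ q (undup_uniq _) sub Wq) c0E.
by rewrite /= mul0r subr0 => /(WJ Wq)/qM[//|/qM[]].
Qed.

Lemma is_coord0_unique e : is_coord 0 e -> e = fun=> 0.
Proof.
move=> [re [L0 [L0e eL]]]; apply/funext => t.
have [tL|/L0e //] := boolP (t \in L0).
pose L := undup L0.
have sub : {subset L0 <= L} by move=> y; rewrite mem_undup.
have tL' : t \in L by exact: sub.
have iL : (index t L < size L)%N by rewrite index_mem.
(* The coefficients of distinct basis elements vanish as sections, hence
   also their germs. *)
have [|||] := @indep_b (size L) (tnth (in_tuple L))
  (fun i => section_of (e (tnth (in_tuple L) i))) _ _ _ (Ordinal iL) _ U0.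
- by apply/tuple_uniqP; exact: undup_uniq.
- by move=> i; apply: section_of_is_section => // p; exact: re.
- move=> q Wq; rewrite big_section_add.
  have := frac_eq_sym idJ (eL L q (undup_uniq _) sub Wq).
  by rewrite /combination big_tnth.
move=> u u0 uE; have : frac_eq [set 0] [set 0] (section_of (e t) [set 0]) (0, 1).
  by exists u => //; move: uE; rewrite (tnth_nth t) /= nth_index.
move=> /(frac_eq0 (is_prime0 A)) /=; rewrite /= mulr1 mul0r.
have [/eqP h0 he] := section_ofP (re t _ U0).
move=> s0.
move/eqP: he; rewrite s0 tofrac0 mulf_eq0 tofrac_eq0 (negPf h0) /=.
by move=> /eqP.
Qed.

(** What is retained of freeness: a linear coordinate map on [B], with finitely
    supported values in the fraction field that are regular on [U], which
    vanishes on [J] and whose kernel lies in every prime ideal over [U]. *)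
Lemma coordinates_exist : exists coord : B -> T -> {fraction A},
  [/\ forall l x y t, coord (phi l * x + y) t = l%:F * coord x t + coord y t,
      forall x, J x -> coord x = fun=> 0,
      forall x, (coord x = fun=> 0) -> forall q, W q -> q x,
      forall x, exists L : seq T, forall t, t \notin L -> coord x t = 0
    & forall x t p, U p -> regular_at p (coord x t)].
Proof.
have [coord coordP] := choice coord_exists; exists coord.
have uniq_coord x e : is_coord x e -> coord x = e.
  move=> xe; have := coord_linear (-1) (coordP x) xe.
  rewrite rmorphN1 mulN1r addNr => /is_coord0_unique E.
  apply/funext => t; apply/esym/eqP; rewrite -subr_eq0 addrC -mulN1r.
  have := congr1 (fun f => f t) E; rewrite /= tofracN tofrac1.
  by move=> ->.
split.
- move=> l x y t; have := coord_linear l (coordP x) (coordP y).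
  by move=> /uniq_coord ->.
- by move=> x /is_coord_ideal/uniq_coord.
- by move=> x x0 q; apply: is_coord0_vanish; rewrite -x0; exact: coordP.
- by move=> x; have [_ [L [L0 _]]] := coordP x; exists L.
- by move=> x t p; have [+ _] := coordP x; apply.
Qed.

End Coordinates.

(** * Integrality at a point of the open set *)

(** An algebraic element of a free algebra is integral near each point of the
    base. The degree relation of [y] confines the coordinates of all powers of
    [y] to a finite set of basis elements, and noetherianity then relates one
    power to the preceding ones. Freeness cannot be weakened to torsion-freeness
    here: in K[a][x] / (a x - 1), where [x] is the inverse of [a], no equation
    of this kind holds at [a = 0]. *)
Lemma free_integral (A : idomainType) (B : comNzRingType) (phi : {rmorphism A -> B})
    (U : set (set A)) (J : set B) (p : set A) (y : B) (P : {poly A}) :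
  noetherian A 1 -> zariski_open [set 0] U -> is_ideal J ->
  free_sections phi [set 0] U J [set q | Spec J q /\ U (phi @^-1` q)] ->
  U p -> P != 0 -> J (map_poly phi P).[y] ->
  exists (N : nat) (g : A) (d : nat -> A), ~ p g /\
    forall q, Spec J q -> U (phi @^-1` q) ->
      q (phi g * y ^+ N - \sum_(i < N) phi (d i) * y ^+ i).
Proof.
move=> noeA oU idJ [T0 [b [sec_b span_b indep_b]]] Up P0 JP.
have U0 := open_generic oU Up.
have [coord [coordL coordJ coord0 coord_supp coord_reg]] :=
  @coordinates_exist A B phi U J oU U0 idJ {classic T0} b sec_b span_b indep_b.
have cz : coord 0 = fun=> 0 by apply: coordJ; case: idJ.
have coordS n (l : nat -> A) (x : nat -> B) t :
    coord (\sum_(i < n) phi (l i) * x i) t = \sum_(i < n) (l i)%:F * coord (x i) t.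
  elim: n => [|n IH]; first by rewrite !big_ord0 cz.
  by rewrite !big_ord_recr /= addrC coordL IH addrC.
pose D := (size P).-1.
have PD : P`_D != 0 by rewrite -lead_coefE lead_coef_eq0.
have sP : size P = D.+1 by rewrite prednK // lt0n size_poly_eq0.
(* Coordinates of y^k P(y), which lies in J. *)
have rel k t : \sum_(i < D.+1) (P`_i)%:F * coord (y ^+ (k + i)) t = 0.
  rewrite -(coordS D.+1 (fun i => P`_i) (fun i => y ^+ (k + i))) coordJ //.
  rewrite (_ : \sum_(i < _) _ = y ^+ k * (map_poly phi P).[y]).
    by case: idJ => _ _; apply.
  rewrite horner_poly sP mulr_sumr; apply: eq_bigr => i _.
  by rewrite exprD mulrCA.
have /choice[S SP] := fun k => coord_supp (y ^+ k).
(* The basis elements that occur in 1, y, ..., y^(D-1). *)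
pose L := flatten [seq S i | i <- iota 0 D].
(* Outside L the relation expresses P_D coord (y^k) through smaller powers,
   and P_D is not zero. *)
have supp k t : t \notin L -> coord (y ^+ k) t = 0.
  move=> tL; elim/ltn_ind: k => k IH; have [kD|Dk] := ltnP k D.
    apply: SP; apply: contra tL => tS; apply/flatten_mapP; exists k => //.
    by rewrite mem_iota.
  have := rel (k - D)%N t; rewrite big_ord_recr /= big1 => [|i _]; last first.
    rewrite IH ?mulr0 //.
    by rewrite -[X in (_ < X)%N](subnK Dk) ltn_add2l.
  rewrite add0r subnK // => /eqP; rewrite mulf_eq0 tofrac_eq0 (negPf PD) /=.
  by move/eqP.
have pp := open_prime oU Up.
have /choice[h hP] : forall k, exists h, ~ p h /\ exists a : {classic T0} -> A,
    forall t, t \in L -> h%:F * coord (y ^+ k) t = (a t)%:F.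
  move=> k; have [|h [ph hP]] := @regular_common _ p [seq coord (y ^+ k) t | t <- L] pp.
    by move=> _ /mapP[t _ ->]; exact: coord_reg.
  by exists h; split=> //; exact: (common_numerators hP).
have /choice[num numP] := fun k => (hP k).2.
(* Numerators of the coordinates of y^k over the common denominator h k. *)
have [N [d dP]] := @noetherian_rank A (size L) noeA
  (fun k j => nth 0 (map (num k) L) j).
exists N, (h N), (fun i => d i * h i); split; first exact: (hP N).1.
move=> q sq Uq; apply: coord0 => //; apply/funext => t.
rewrite addrC -mulN1r -(rmorphN1 phi) coordL.
have -> : phi (h N) * y ^+ N = phi (h N) * y ^+ N + 0 by rewrite addr0.
rewrite coordL cz addr0 (coordS N (fun i => d i * h i) (fun i => y ^+ i)).
rewrite tofracN tofrac1 mulN1r.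
have [tL|tL] := boolP (t \in L); last first.
  rewrite supp // mulr0 addr0 big1 ?oppr0 // => i _.
  by rewrite supp // mulr0.
rewrite numP //; have := dP (index t L); rewrite index_mem => /(_ tL).
rewrite (nth_map t) ?index_mem // nth_index // => ->.
rewrite rmorph_sum -sumrN -big_split big1 // => i _ /=.
rewrite (nth_map t) ?index_mem // nth_index // !tofracM -mulrA numP //.
by rewrite addNr.
Qed.

(** * Polynomial families as functions of parameters and variables *)

(** Matrices are normed modules and complete uniform spaces; this declares the
    join of the two structures, on which the contraction principle is stated. *)
HB.instance Definition _ (R : realType) (m n : nat) := Complete.on 'M[R]_(m, n).

Section Evaluation.
Variables (R : realType) (n m : nat).
Local Notation fam := {mpoly {mpoly R[m]}[n]}.

(** Evaluation of the parameters, then of the variables; on [F i] this is by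
    conversion the [i]-th equation of [member F alpha] at [x]. *)
Definition feval (alpha : 'rV[R]_m) (x : 'rV[R]_n) (P : fam) : R :=
  (map_mpoly (meval (alpha ord0)) P).@[x ord0].

HB.instance Definition _ alpha x := GRing.RMorphism.copy (feval alpha x)
  (meval (x ord0) \o map_mpoly (meval (alpha ord0))).

Lemma fevalC alpha x c : feval alpha x c%:MP = c.@[alpha ord0].
Proof. by rewrite /feval map_mpolyC mevalC. Qed.

Lemma fevalX alpha x j : feval alpha x 'X_j = x ord0 j.
Proof. by rewrite /feval map_mpolyX mevalXU. Qed.

Section Continuity.
Variables (X : topologicalType).

Lemma continuous_sum_seq (I : Type) (r : seq I) (f : I -> X -> R) :
  (forall i, continuous (f i)) -> continuous (fun w => \sum_(i <- r) f i w).
Proof.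
move=> cf; elim: r => [|i r IH] w.
  by under eq_fun do rewrite big_nil; exact: cvg_cst.
by under eq_fun do rewrite big_cons; apply: cvgD; [exact: cf|exact: IH].
Qed.

Lemma continuous_prod_seq (I : Type) (r : seq I) (f : I -> X -> R) :
  (forall i, continuous (f i)) -> continuous (fun w => \prod_(i <- r) f i w).
Proof.
move=> cf; elim: r => [|i r IH] w.
  by under eq_fun do rewrite big_nil; exact: cvg_cst.
by under eq_fun do rewrite big_cons; apply: cvgM; [exact: cf|exact: IH].
Qed.

Lemma continuous_exp_fun (f : X -> R) k :
  continuous f -> continuous (fun w => f w ^+ k).
Proof.
move=> cf; elim: k => [|k IH] w; first exact: cvg_cst.
by under eq_fun do rewrite exprS; apply: cvgM; [exact: cf|exact: IH].
Qed.

Lemma continuous_meval (k : nat) (a : 'I_k -> X -> R) (p : {mpoly R[k]}) :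
  (forall i, continuous (a i)) -> continuous (fun w => p.@[a^~ w]).
Proof.
move=> ca; elim/mpolyind: p => [|c mm p _ _ IH] w.
  by under eq_fun do rewrite meval0; exact: cvg_cst.
under eq_fun do rewrite mevalD mevalZ mevalX.
apply: cvgD; last exact: IH.
apply: cvgM; first exact: cvg_cst.
by apply: continuous_prod_seq => i; exact: continuous_exp_fun.
Qed.

Lemma continuous_feval (a : X -> 'rV[R]_m) (x : X -> 'rV[R]_n) (P : fam) :
  continuous a -> continuous x -> continuous (fun w => feval (a w) (x w) P).
Proof.
move=> ca cx; rewrite /feval; elim/mpolyind: P => [|c mm p _ _ IH] w.
  by under eq_fun do rewrite rmorph0 meval0; exact: cvg_cst.
under eq_fun do rewrite rmorphD /= mevalD map_mpolyZ mevalZ map_mpolyX mevalX.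
apply: cvgD; last exact: IH.
have cc k (b : X -> 'rV[R]_k) i : continuous b -> continuous (fun w => b w ord0 i).
  move=> cb w'; apply: (cvg_comp b (fun M : 'rV[R]_k => M ord0 i) (cb w')).
  exact: coord_continuous.
apply: cvgM.
  by apply: (@continuous_meval m (fun i w => a w ord0 i)) => i; exact: cc.
apply: (@continuous_prod_seq _ _ (fun i w => x w ord0 i ^+ mm i)) => i.
by apply: continuous_exp_fun; exact: cc.
Qed.
End Continuity.

(** An algebraic mean value formula: the property is stable under sums and,
    with the Leibniz rule f(x)g(x) - f(y)g(y) =
    (f(x) - f(y)) g(x) + f(y) (g(x) - g(y)), under products. *)
Lemma feval_divided_difference (P : fam) :
  exists Q : 'I_n -> 'rV[R]_m -> 'rV[R]_n -> 'rV[R]_n -> R,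
  [/\ forall j, continuous (fun w : 'rV[R]_m * ('rV[R]_n * 'rV[R]_n) =>
                               Q j w.1 w.2.1 w.2.2),
      forall alpha x y, feval alpha x P - feval alpha y P =
        \sum_j (x ord0 j - y ord0 j) * Q j alpha x y
    & forall j alpha x, Q j alpha x x =
        (map_mpoly (meval (alpha ord0)) P)^`M(j).@[x ord0]].
Proof.
pose w1 (w : 'rV[R]_m * ('rV[R]_n * 'rV[R]_n)) := w.1.
pose w2 (w : 'rV[R]_m * ('rV[R]_n * 'rV[R]_n)) := w.2.1.
pose w3 (w : 'rV[R]_m * ('rV[R]_n * 'rV[R]_n)) := w.2.2.
have c1 : continuous w1 by move=> w; exact: cvg_fst.
have c2 : continuous w2.
  by move=> w; apply: (cvg_comp snd fst); [exact: cvg_snd|exact: cvg_fst].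
have c3 : continuous w3.
  by move=> w; apply: (cvg_comp snd snd); [exact: cvg_snd|exact: cvg_snd].
(* The property to be proved by closure under the ring operations. *)
pose dd P := exists Q : 'I_n -> 'rV[R]_m -> 'rV[R]_n -> 'rV[R]_n -> R,
  [/\ forall j, continuous (fun w => Q j (w1 w) (w2 w) (w3 w)),
      forall alpha x y, feval alpha x P - feval alpha y P =
        \sum_j (x ord0 j - y ord0 j) * Q j alpha x y
    & forall j alpha x, Q j alpha x x =
        (map_mpoly (meval (alpha ord0)) P)^`M(j).@[x ord0]].
have ddC c : dd c%:MP.
  exists (fun _ _ _ _ => 0); split.
  - by move=> j w; exact: cvg_cst.
  - move=> alpha x y; rewrite /feval !map_mpolyC !mevalC subrr.
    by rewrite big1 // => j _; rewrite mulr0.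
  - by move=> j alpha x; rewrite map_mpolyC mderivC meval0.
have ddX i : dd 'X_i.
  exists (fun j _ _ _ => (i == j)%:R); split.
  - by move=> j w; exact: cvg_cst.
  - move=> alpha x y; rewrite /feval !map_mpolyX !mevalXU (bigD1 i) //= eqxx mulr1.
    by rewrite big1 ?addr0 // => j ji; rewrite eq_sym (negPf ji) mulr0.
  - move=> j alpha x; rewrite map_mpolyX mderivX mnm1E mevalZ.
    case: eqP => [->|_]; last by rewrite mul0r.
    by rewrite mevalX big1 ?mulr1 // => k _; rewrite mnmBE subnn.
have ddD p q : dd p -> dd q -> dd (p + q).
  move=> [P1 [cP Pe Pd]] [Q [cQ Qe Qd]].
  exists (fun j alpha x y => P1 j alpha x y + Q j alpha x y); split.
  - by move=> j w; apply: cvgD; [exact: cP|exact: cQ].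
  - move=> alpha x y; rewrite /feval !rmorphD /= opprD addrACA.
    rewrite -!/(feval _ _ _) Pe Qe -big_split; apply: eq_bigr => j _ /=.
    by rewrite mulrDr.
  - by move=> j alpha x; rewrite Pd Qd rmorphD mderivD mevalD.
have ddM p q : dd p -> dd q -> dd (p * q).
  move=> [P1 [cP Pe Pd]] [Q [cQ Qe Qd]].
  exists (fun j alpha x y =>
    P1 j alpha x y * feval alpha x q + feval alpha y p * Q j alpha x y); split.
  - move=> j w; apply: cvgD; apply: cvgM; [exact: cP| | |exact: cQ].
      exact: (continuous_feval c1 c2).
    exact: (continuous_feval c1 c3).
  - move=> alpha x y.
    have fM z : feval alpha z (p * q) = feval alpha z p * feval alpha z q.
      by rewrite /feval !rmorphM.
    have splitM (a b c d : R) : a * b - c * d = (a - c) * b + c * (b - d) by ring.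
    rewrite !fM splitM Pe Qe mulr_suml mulr_sumr -big_split.
    apply: eq_bigr => j _ /=; rewrite mulrDr -mulrA; congr (_ + _).
    by rewrite mulrCA.
  - by move=> j alpha x; rewrite Pd Qd rmorphM mderivM mevalD !mevalM.
exact: (@mpoly_ring_ind _ _ dd ddC ddX ddD ddM).
Qed.

End Evaluation.

(** * Persistence of nondegenerate zeros *)

Section RowNorm.
Variables (R : realType) (n : nat).
Implicit Types v : 'rV[R]_n.

Lemma rV_norm_leP v (c : R) : 0 <= c ->
  (forall j, `|v ord0 j| <= c) <-> `|v| <= c.
Proof.
move=> c0; rewrite -[`|v|]/(mx_norm v) mx_normrE; split=> [vc|].
  by apply: bigmax_le => // -[i j] _ /=; rewrite ord1.
move=> vc j; apply: le_trans vc.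
exact: (@le_bigmax _ _ _ 0 (fun ij : 'I_1 * 'I_n => `|v ij.1 ij.2|) (ord0, j)).
Qed.

Lemma rV_coord_le v j : `|v ord0 j| <= `|v|.
Proof. exact: (rV_norm_leP v (normr_ge0 v)).2. Qed.

(** Each of the [n] terms of a coordinate is at most [`|v| / (2 * n.+1)];
    [n.+1] instead of [n] keeps the bound on the entries positive when
    [n = 0]. *)
Lemma rV_mulmx_norm_le v (E : 'M[R]_n) :
  (forall i j, `|E i j| <= (2 * n.+1%:R)^-1) -> `|v *m E| <= 2^-1 * `|v|.
Proof.
move=> hE; apply/rV_norm_leP => [|j]; first by rewrite mulr_ge0 // invr_ge0.
rewrite mxE; apply: le_trans (ler_norm_sum _ _ _) _.
apply: (@le_trans _ _ (\sum_(k < n) `|v| * (2 * n.+1%:R)^-1)).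
  by apply: ler_sum => k _; rewrite normrM; apply: ler_pM => //; exact: rV_coord_le.
rewrite sumr_const card_ord -[leLHS]mulr_natr -[leLHS]mulrA [leLHS]mulrC ler_wpM2r //.
rewrite mulrC ler_pdivrMr ?mulr_gt0 ?ltr0n // mulKf ?pnatr_eq0 //.
by rewrite ler_nat.
Qed.

End RowNorm.

Lemma contraction_fixpoint (R : realType) (V : completeNormedModType R)
    (z : V) (r : R) (g : V -> V) : 0 < r ->
  (forall x, `|z - x| <= r -> `|z - g x| <= r) ->
  (forall x y, `|z - x| <= r -> `|z - y| <= r -> `|g x - g y| <= 2^-1 * `|x - y|) ->
  exists x, `|z - x| <= r /\ g x = x.
Proof.
move=> r0 gU gL; pose U := [set x | `|z - x| <= r].
have gUU : {homo g : x / U x} by exact: gU.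
have [|||x Ux xg] := @banach_fixed_point R V U (mkfun_fun gUU).
- exists (2^-1)%:nng; split => /=; first by rewrite invf_lt1 // ltr1n.
  by move=> [x y] [/= Ux Uy]; exact: gL.
- by have := @closed_ball_closed R V z r; rewrite closed_ballE.
- by exists z; rewrite /U /= subrr normr0 ltW.
by exists x; split => //; rewrite [RHS]xg.
Qed.

Section LocalZero.
Variables (R : realType) (n m : nat) (F : 'I_n -> {mpoly {mpoly R[m]}[n]}).
Variables (alpha0 : 'rV[R]_m) (z : 'rV[R]_n).

(** Apply the contraction principle to the simplified Newton map at [z], on a
    ball that does not depend on [alpha]. *)
Lemma locally_unique_zero (eps : R) :
  zeros (member F alpha0) z ->
  \det (\matrix_(i, j) (member F alpha0 i)^`M(j).@[z ord0]) != 0 ->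
  0 < eps -> exists r, [/\ 0 < r, r < eps &
    \forall alpha \near alpha0, exists x,
      [/\ `|z - x| <= r, zeros (member F alpha) x &
          forall x', `|z - x'| <= r -> zeros (member F alpha) x' -> x' = x]].
Proof.
move=> z0 detJ eps0.
have /choice[Q QP] := fun i => feval_divided_difference (F i).
pose X := ('rV[R]_m * ('rV[R]_n * 'rV[R]_n))%type.
pose Qm (w : X) : 'M[R]_n := \matrix_(j, i) Q i j w.1 w.2.1 w.2.2.
pose w0 : X := (alpha0, (z, z)).
have Qw0 : Qm w0 = (\matrix_(i, j) (member F alpha0 i)^`M(j).@[z ord0])^T.
  by apply/matrixP => j i; rewrite !mxE; have [_ _] := QP i; exact.
have Qunit : Qm w0 \in unitmx by rewrite Qw0 unitmxE det_tr unitfE.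
pose M := invmx (Qm w0).
(* E measures the Lipschitz constant of the Newton map g below; it vanishes
   at w0. *)
pose E w : 'M[R]_n := 1%:M - Qm w *m M.
have Ew0 : E w0 = 0 by rewrite /E mulmxV // subrr.
have cE i j : continuous (fun w => E w i j).
  move=> w.
  rewrite (_ : (fun w => E w i j) =
    fun w => (1%:M : 'M[R]_n) i j - \sum_k Q k i w.1 w.2.1 w.2.2 * M k j); last first.
    by apply/funext => v; rewrite !mxE; congr (_ - _); apply: eq_bigr => k _; rewrite mxE.
  apply: cvgB; first exact: cvg_cst.
  apply: (@continuous_sum_seq R X _ _ (fun k w => Q k i w.1 w.2.1 w.2.2 * M k j)).
  move=> k v; apply: cvgM; last exact: cvg_cst.
  by have [+ _ _] := QP k; apply.
pose eta : R := (2 * n.+1%:R)^-1.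
have eta0 : 0 < eta by rewrite invr_gt0 mulr_gt0.
have : \forall w \near w0, forall ij : 'I_n * 'I_n, `|E w ij.1 ij.2| < eta.
  apply: (@filter_forall _ _ (fun (ij : 'I_n * 'I_n) w =>
    `|E w ij.1 ij.2| < eta) (nbhs w0) (nbhs_filter w0)).
  move=> -[i j] /=.
  have cE0 : (fun w => E w i j) @ w0 --> (0 : R).
    by have := cE i j w0; rewrite /continuous_at Ew0 mxE.
  exact: (cvgr0_norm_lt _ cE0).
move=> /nbhs_ballP[e /= e0 eE].
pose r := Num.min e eps / 2.
have me0 : 0 < Num.min e eps by rewrite lt_min e0.
have r0 : 0 < r by rewrite divr_gt0.
have rlt : r < Num.min e eps by rewrite /r ltr_pdivrMr // ltr_pMr // ltr1n.
exists r; split=> //; first by rewrite (lt_le_trans rlt) // ge_min lexx orbT.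
pose Fv alpha x : 'rV[R]_n := \row_i feval alpha x (F i).
have FvE alpha x : zeros (member F alpha) x <-> Fv alpha x = 0.
  split=> [H|/rowP H i]; first by apply/rowP => i; rewrite !mxE; exact: H.
  by have := H i; rewrite !mxE.
have FvB alpha x y : Fv alpha x - Fv alpha y = (x - y) *m Qm (alpha, (x, y)).
  apply/rowP => i; rewrite !mxE; have [_ -> _] := QP i.
  by apply: eq_bigr => j _; rewrite !mxE.
pose g alpha x : 'rV[R]_n := x - Fv alpha x *m M.
have gB alpha x y : g alpha x - g alpha y = (x - y) *m E (alpha, (x, y)).
  rewrite /E mulmxBr mulmx1 mulmxA -FvB /g mulmxBl !opprB.
  by rewrite addrACA [RHS]addrACA; congr (_ + _); exact: addrC.
have gfix alpha x : g alpha x = x <-> zeros (member F alpha) x.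
  rewrite FvE /g; split=> [/eqP|->]; last by rewrite mul0mx subr0.
  rewrite -subr_eq0 addrAC subrr add0r oppr_eq0 => /eqP FM.
  by rewrite -[LHS]mulmx1 -(mulVmx Qunit) mulmxA FM mul0mx.
(* The Newton map moves the center of the ball by at most r / 2; with
   Lipschitz constant 1 / 2 it therefore preserves the ball of radius r. *)
have nearz : \forall alpha \near alpha0, forall j, `|(Fv alpha z *m M) ord0 j| < r / 2.
  apply: (@filter_forall _ _ (fun j alpha =>
    `|(Fv alpha z *m M) ord0 j| < r / 2) (nbhs alpha0) (nbhs_filter alpha0)).
  move=> j.
  suff cF : (fun alpha => (Fv alpha z *m M) ord0 j) @ alpha0 --> (0 : R).
    by apply: (cvgr0_norm_lt _ cF); rewrite divr_gt0.
  rewrite (_ : 0 = (Fv alpha0 z *m M) ord0 j); last first.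
    by have /FvE -> := z0; rewrite mul0mx mxE.
  rewrite (_ : (fun alpha => _) =
     fun alpha => \sum_k feval alpha z (F k) * M k j); last first.
    by apply/funext => alpha; rewrite mxE; apply: eq_bigr => k _; rewrite mxE.
  rewrite mxE (eq_bigr (fun k => feval alpha0 z (F k) * M k j)); last first.
    by move=> k _; rewrite mxE.
  apply: (@continuous_sum_seq R 'rV[R]_m _ _ (fun k alpha =>
    feval alpha z (F k) * M k j)).
  have cfe k : continuous (fun alpha : 'rV[R]_m => feval alpha z (F k)).
    apply: (@continuous_feval R n m 'rV[R]_m id (fun=> z)) => w.
      exact: cvg_id.
    exact: cst_continuous.
  by move=> k alpha; apply: (cvgM (cfe k alpha)); exact: cvg_cst.
have nearb : \forall alpha \near alpha0, ball alpha0 e alpha by exact: nbhsx_ballx.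
near=> alpha.
have al_e : ball alpha0 e alpha by near: alpha.
have al_z : forall j, `|(Fv alpha z *m M) ord0 j| < r / 2 by near: alpha.
have gL x y : `|z - x| <= r -> `|z - y| <= r ->
    `|g alpha x - g alpha y| <= 2^-1 * `|x - y|.
  move=> zx zy; rewrite gB; apply: rV_mulmx_norm_le => i j; apply/ltW.
  have re : r < e by rewrite (lt_le_trans rlt) // ge_min lexx.
  apply: (eE (alpha, (x, y)) _ (i, j)); split=> //=.
  by split=> /=; rewrite -ball_normE /ball_ /=; exact: le_lt_trans re.
have gU x : `|z - x| <= r -> `|z - g alpha x| <= r.
  move=> zx; rewrite -(subrK (g alpha z) z) -addrA.
  apply: le_trans (ler_normD _ _) _.
  rewrite [leRHS](splitr r) lerD //.
    rewrite /g opprB addrC subrK; apply/rV_norm_leP; first by rewrite divr_ge0 ?ltW.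
    by move=> j; exact/ltW/al_z.
  apply: (le_trans (gL _ _ _ zx)); first by rewrite subrr normr0 ltW.
  by rewrite mulrC ler_wpM2r.
have [x [zx /gfix x0]] := contraction_fixpoint r0 gU gL.
exists x; split=> // x' zx' /gfix gx'.
have /gfix gx := x0.
have := gL _ _ zx' zx; rewrite gx gx' => H.
apply/eqP; rewrite -subr_eq0 -normr_le0; lra.
Unshelve. all: by end_near. Qed.

End LocalZero.

(** * Bounds on roots and local constancy of the number of zeros *)

(** If [`|t| > 1] then c |t|^N <= (sum_i D_i) |t|^(N-1). *)
Lemma root_bound (R : realType) (N : nat) (c g t : R) (d D : 'I_N -> R) :
  0 < c -> c <= `|g| -> (forall i, `|d i| <= D i) ->
  g * t ^+ N = \sum_(i < N) d i * t ^+ i ->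
  `|t| <= 1 + (\sum_i D i) / c.
Proof.
move=> c0 cg dD E.
have D0 i : 0 <= D i by apply: le_trans (dD i).
have SD : 0 <= \sum_i D i by apply: sumr_ge0.
have [t1|t1] := leP `|t| 1; first by rewrite (le_trans t1) // lerDl divr_ge0 // ltW.
case: N d D E dD D0 SD => [|N] d D E dD D0 SD.
  move: E; rewrite big_ord0 expr0 mulr1 => g0.
  by move: cg; rewrite g0 normr0 leNgt c0.
have tN : 0 < `|t| ^+ N by rewrite exprn_gt0 // (lt_trans ltr01).
have : c * `|t| ^+ N.+1 <= (\sum_i D i) * `|t| ^+ N.
  apply: (@le_trans _ _ (`|g| * `|t| ^+ N.+1)); first by rewrite ler_wpM2r // exprn_ge0.
  rewrite -normrX -normrM E; apply: le_trans (ler_norm_sum _ _ _) _.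
  rewrite mulr_suml; apply: ler_sum => i _; rewrite normrM normrX.
  apply: ler_pM => //.
  by rewrite ler_weXn2l // ?ltW // -ltnS.
rewrite exprS mulrA ler_pM2r // => H.
by rewrite ler_wpDl // ler_pdivlMr // mulrC.
Qed.

Lemma bounded_roots_near (R : realType) (m N : nat) (alpha0 : 'rV[R]_m)
    (g : {mpoly R[m]}) (d : nat -> {mpoly R[m]}) :
  g.@[alpha0 ord0] != 0 ->
  exists C : R, \forall alpha \near alpha0, forall t : R,
    g.@[(alpha : 'rV[R]_m) ord0] * t ^+ N = \sum_(i < N) (d i).@[alpha ord0] * t ^+ i ->
    `|t| <= C.
Proof.
move=> g0.
have cm (p : {mpoly R[m]}) :
    (fun alpha : 'rV[R]_m => p.@[alpha ord0]) @ alpha0 --> p.@[alpha0 ord0].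
  apply: (@continuous_meval R 'rV[R]_m m (fun i alpha => alpha ord0 i)) => i.
  exact: coord_continuous.
pose c := `|g.@[alpha0 ord0]| / 2.
have c0 : 0 < c by rewrite divr_gt0 // normr_gt0.
exists (1 + (\sum_(i < N) (`|(d i).@[alpha0 ord0]| + 1)) / c).
have nearg : \forall alpha \near alpha0,
    `|g.@[alpha0 ord0] - g.@[(alpha : 'rV[R]_m) ord0]| < c.
  by have /cvgrPdist_lt := cm g; apply.
have neard : \forall alpha \near alpha0, forall i : 'I_N,
    `|(d i).@[alpha0 ord0] - (d i).@[(alpha : 'rV[R]_m) ord0]| < 1.
  apply: (@filter_forall _ _ (fun (i : 'I_N) alpha =>
    `|(d i).@[alpha0 ord0] - (d i).@[(alpha : 'rV[R]_m) ord0]| < 1)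
    (nbhs alpha0) (nbhs_filter alpha0)).
  by move=> i; have /cvgrPdist_lt := cm (d i); apply.
near=> alpha => t.
apply: (@root_bound R N c _ t (fun i => (d i).@[alpha ord0])) => //.
  have H : `|g.@[alpha0 ord0] - g.@[alpha ord0]| < c by near: alpha.
  have := ler_normD (g.@[alpha0 ord0] - g.@[alpha ord0]) g.@[alpha ord0].
  rewrite subrK => H'; rewrite /c in H *; lra.
move=> i; have H : `|(d i).@[alpha0 ord0] - (d i).@[alpha ord0]| < 1.
  by move: i; near: alpha.
have := ler_normD ((d i).@[alpha ord0] - (d i).@[alpha0 ord0]) (d i).@[alpha0 ord0].
rewrite subrK distrC => H'; lra.
Unshelve. all: by end_near. Qed.

Section Count.
Variables (R : realType) (n m : nat) (F : 'I_n -> {mpoly {mpoly R[m]}[n]}).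
Variable alpha0 : 'rV[R]_m.

Lemma separating_radius (k : nat) (z : 'I_k -> 'rV[R]_n) : injective z ->
  exists2 eps : R, 0 < eps & forall i j, i != j -> 2 * eps <= `|z i - z j|.
Proof.
move=> zinj.
(* Half the least distance between two of the points, but at most 1, which
   is the value when there is only one point. *)
exists (\big[Num.min/1]_(ij : 'I_k * 'I_k | ij.1 != ij.2) (`|z ij.1 - z ij.2| / 2)).
  apply/bigmin_gtP; split=> // -[i j] /= ij.
  by rewrite divr_gt0 // normr_gt0 subr_eq0 (inj_eq zinj).
move=> i j ij; rewrite mulrC -ler_pdivlMr //.
exact: (@bigmin_le_cond _ _ _ 1 (i, j) (fun ij : 'I_k * 'I_k => ij.1 != ij.2)
  (fun ij => `|z ij.1 - z ij.2| / 2)).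
Qed.

(** The zeros over [alpha] are sent bijectively to those over [alpha0]: each
    ball around a zero over [alpha0] contains exactly one of them, and by
    compactness of the box none lies elsewhere. *)
Lemma card_zeros_near (mu : nat) (C : 'I_n -> R) :
  (forall z, zeros (member F alpha0) z ->
     \det (\matrix_(i, j) (member F alpha0 i)^`M(j).@[z ord0]) != 0) ->
  zeros (member F alpha0) #= `I_mu ->
  (\forall alpha \near alpha0, forall x, zeros (member F alpha) x ->
     forall j, `|(x : 'rV[R]_n) ord0 j| <= C j) ->
  \forall alpha \near alpha0, zeros (member F alpha) #= `I_mu.
Proof.
move=> detJ; rewrite card_eq_sym => /card_set_bijP[f [fI finj fsurj]] bnd.
pose z (i : 'I_mu) := f i.
have zzero i : zeros (member F alpha0) (z i) by apply: fI; exact: ltn_ord.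
have zinj : injective z.
  by move=> i j /finj H; apply/val_inj/H; rewrite inE /=.
have zsurj x : zeros (member F alpha0) x -> exists i, x = z i.
  by move=> /fsurj[k /= kmu <-]; exists (Ordinal kmu).
have [eps eps0 sep] := separating_radius zinj.
have /choice[r rP] := fun i => locally_unique_zero (zzero i) (detJ _ (zzero i)) eps0.
have near1 : \forall alpha \near alpha0, forall i, exists x,
      [/\ `|z i - x| <= r i, zeros (member F alpha) x &
          forall x', `|z i - x'| <= r i -> zeros (member F alpha) x' -> x' = x].
  apply: (@filter_forall _ _ (fun i alpha => exists x,
      [/\ `|z i - x| <= r i, zeros (member F alpha) x &
          forall x', `|z i - x'| <= r i -> zeros (member F alpha) x' -> x' = x])
    (nbhs alpha0) (nbhs_filter alpha0)).
  by move=> i; have [] := rP i.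
pose K := [set x : 'rV[R]_n | forall j, `[- C j, C j] (x ord0 j)].
have /compact_near_coveringP cK : compact K.
  by apply: (@rV_compact R n (fun j => `[- C j, C j])) => j; exact: segment_compact.
have near2 : \forall alpha \near alpha0, K `<=`
    [set x | zeros (member F alpha) x -> exists i, `|z i - x| <= r i].
  apply: (cK _ (nbhs alpha0) (fun alpha x =>
    zeros (member F alpha) x -> exists i, `|z i - x| <= r i) (nbhs_filter alpha0))
    => x Kx.
  have [/zsurj[i ->]|nz] := pselect (zeros (member F alpha0) x).
    exists ([set x' | `|z i - x'| <= r i], setT).
      split; last exact: filterT.
      apply/nbhs_ballP; have [ri _ _] := rP i; exists (r i) => // x'.
      by rewrite -ball_normE /ball_ /= => /ltW.
    by move=> [x' alpha] [/= zx' _] _; exists i.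
  have [k k0] : exists k, feval alpha0 x (F k) != 0.
    apply: contrapT => H; apply: nz => k.
    by apply/eqP/negP => /negP H'; apply: H; exists k.
  have ck : continuous (fun w : 'rV[R]_n * 'rV[R]_m => feval w.2 w.1 (F k)).
    by apply: continuous_feval => w; [exact: cvg_snd|exact: cvg_fst].
  have [[A B] /= nAB AB] := cvgr_neq0 _ (ck (x, alpha0)) k0.
  exists (A, B) => // -[x' alpha] Dx zx'; have /eqP H := AB (x', alpha) Dx.
  by exfalso; apply: H; exact: (zx' k).
near=> alpha.
have H1 : forall i, exists x,
      [/\ `|z i - x| <= r i, zeros (member F alpha) x &
          forall x', `|z i - x'| <= r i -> zeros (member F alpha) x' -> x' = x].
  by near: alpha.
have H2 : K `<=` [set x | zeros (member F alpha) x -> exists i, `|z i - x| <= r i].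
  by near: alpha.
have H3 : forall x, zeros (member F alpha) x -> forall j, `|(x : 'rV[R]_n) ord0 j| <= C j.
  by near: alpha.
have [g gP] := choice H1.
(* Extend g to all natural numbers, as the index set `I_mu requires. *)
pose h k := if insub k is Some i then g i else 0.
have hE (i : 'I_mu) : h i = g i by rewrite /h valK.
rewrite (_ : zeros _ = h @` `I_mu).
  apply: inj_card_eq => k l; rewrite !inE /= => kmu lmu.
  rewrite -[k]/(val (Ordinal kmu)) -[l]/(val (Ordinal lmu)) !hE => gkl.
  congr val; apply/eqP; apply: contraT => /sep.
  have [zk _ _] := gP (Ordinal kmu); have [zl _ _] := gP (Ordinal lmu).
  have [_ rk _] := rP (Ordinal kmu); have [_ rl _] := rP (Ordinal lmu).
  have := ler_normD (z (Ordinal kmu) - g (Ordinal kmu))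
    (g (Ordinal kmu) - z (Ordinal lmu)).
  rewrite addrA subrK (distrC (g (Ordinal kmu)) (z (Ordinal lmu))) => H4 H5.
  rewrite -gkl in zl.
  exfalso; lra.
apply/seteqP; split=> [x zx|_ [k /= kmu <-]]; last first.
  by have [] := gP (Ordinal kmu); rewrite -hE.
have [|i ix] := H2 x _ zx; first by move=> j; rewrite /= in_itv /= -ler_norml; exact: H3.
exists i; first exact: ltn_ord.
by rewrite hE; have [_ _ gu] := gP i; rewrite (gu x).
Unshelve. all: by end_near. Qed.

End Count.

(** * Real fibers of an optimal family *)

(** Baire: an injection into [nat] would make the whole line a countable union
    of closed sets with at most one point. *)
Lemma uncountable_realType (R : realType) : ~ countable [set: R].
Proof.
move=> /countable_injP[g ginj].
have g1 x y : g x = g y -> x = y by move=> /(ginj _ _ (in_setT _) (in_setT _)).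
have oF i : open (~` (g @^-1` [set i])) /\ dense (~` (g @^-1` [set i])).
  split.
    apply: closed_openC; have [[x gx]|no] := pselect (exists x, g x = i).
      rewrite (_ : _ @^-1` _ = [set x]); first exact: closed_eq.
      by apply/seteqP; split=> y /=; [rewrite -gx => /g1|move=> ->].
    rewrite (_ : _ @^-1` _ = set0); first exact: closed0.
    by apply/seteqP; split=> y //= gy; apply: no; exists y.
  move=> O [x Ox] oO; have [e /= e0 eO] :=
    (nbhs_ballP _ _).1 (open_nbhs_nbhs (conj oO Ox)).
  have [gx|gx] := eqVneq (g x) i; last by exists x; split=> //; apply/eqP.
  exists (x + e / 2); split.
    apply: eO; rewrite -ball_normE /ball_ /= opprD addNKr normrN ger0_norm; lra.
  by rewrite /= -gx => /g1; lra.
have [||a [_ Fa]] := @Baire R R _ oF setT; [by exists 0|exact: openT|].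
exact: (Fa (g a) I erefl).
Qed.

Lemma uncountable_fraction_mpoly (R : realType) (m : nat) :
  ~ countable [set: {fraction {mpoly R[m]}}].
Proof.
move=> /countable_injP[f finj]; apply: (@uncountable_realType R).
apply/countable_injP; exists (fun c => f (tofrac c%:MP)).
move=> x y _ _ /(finj _ _ (in_setT _) (in_setT _))/eqP.
by rewrite tofrac_eq mpolyC_eq => /eqP.
Qed.

Section RealPoints.
Variables (R : realType) (n m : nat) (F : 'I_n -> {mpoly {mpoly R[m]}[n]}).

(** The point of the total space given by a real zero of a real fiber. *)
Definition point_ideal (alpha : 'rV[R]_m) (x : 'rV[R]_n) :
  set {mpoly {mpoly R[m]}[n]} := feval alpha x @^-1` [set 0].

Lemma point_ideal_spec alpha x : zeros (member F alpha) x ->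
  Spec (ideal_gen F) (point_ideal alpha x).
Proof.
move=> zx; have pP : is_prime (point_ideal alpha x).
  exact: (@prime_kernel R {mpoly {mpoly R[m]}[n]} (feval alpha x)).
split=> // _ [c ->]; have /is_primeP[idP _ _] := pP.
by apply: is_ideal_sum => // i; case: idP => _ _; apply; exact: zx.
Qed.

Lemma point_ideal_base alpha x :
  @mpolyC n {mpoly R[m]} @^-1` point_ideal alpha x = [set c | c.@[alpha ord0] = 0].
Proof. by apply/funext => c; rewrite /point_ideal /= fevalC. Qed.

Lemma rational_points_near (U : set (set {mpoly R[m]})) alpha0 :
  zariski_open [set 0] U -> rational_points U alpha0 ->
  \forall alpha \near alpha0, rational_points U alpha.
Proof.
move=> [E ->] [_ /= Ea].
have [e Ee e0] : exists2 e : {mpoly R[m]}, E e & e.@[alpha0 ord0] != 0.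
  apply: contrapT => H; apply: Ea => e Ee; apply/eqP/negP => /negP e0.
  by apply: H; exists e.
have ce : (fun alpha : 'rV[R]_m => e.@[alpha ord0]) @ alpha0 --> e.@[alpha0 ord0].
  apply: (@continuous_meval R 'rV[R]_m m (fun i alpha => alpha ord0 i)) => i.
  exact: coord_continuous.
have ne := cvgr_neq0 _ ce e0.
near=> alpha; split; last first.
  move=> /(_ e Ee) /= /eqP; apply/negP; near: alpha; exact: ne.
split; last by move=> _ ->; rewrite /= meval0.
exact: (@prime_kernel R {mpoly R[m]} (meval (alpha ord0))).
Unshelve. all: by end_near. Qed.

(** The residue field at a rational point is [R], so smoothness of the fiber
    applies to the evaluation at [alpha], at the maximal ideal of [z]. *)
Lemma smooth_zero (U : set (set {mpoly R[m]})) alpha z :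
  I_optimal F U -> rational_points U alpha -> zeros (member F alpha) z ->
  \det (\matrix_(i, j) (member F alpha i)^`M(j).@[z ord0]) != 0.
Proof.
move=> [_ _ smooth _] Ua za; apply/eqP => det0.
pose phi : {rmorphism {mpoly R[m]} -> R} := meval (alpha ord0).
have [|_ sm] := smooth _ Ua R phi.
  split=> // c; exists c%:MP, 1; rewrite rmorph1 oner_neq0 divr1 /=; split=> //.
  by rewrite mevalC.
pose q : set {mpoly R[n]} := meval (z ord0) @^-1` [set 0].
have pq : is_prime q by exact: (@prime_kernel R {mpoly R[n]} (meval (z ord0))).
have sq : Spec (ideal_gen (fun i => map_mpoly phi (F i))) q.
  split=> // _ [c ->]; have /is_primeP[idP _ _] := pq.
  by apply: is_ideal_sum => // i; case: idP => _ _; apply; exact: za.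
apply: (sm q sq); rewrite /q /= -det_map_mx -[RHS]det0; congr (\det _).
by apply/matrixP => i j; rewrite !mxE.
Qed.

(** Each coordinate function satisfies an equation over R[a] whose leading
    coefficient does not vanish at [alpha0]. *)
Lemma zeros_bounded_near (U : set (set {mpoly R[m]})) alpha0 :
  zero_dim_complete_intersection (generic_member F) ->
  I_optimal F U -> rational_points U alpha0 ->
  exists C : 'I_n -> R, \forall alpha \near alpha0, forall x,
    zeros (member F alpha) x -> forall j, `|(x : 'rV[R]_n) ord0 j| <= C j.
Proof.
move=> [d dimd dn] [oU _ _ free] Ua0.
have d0 : d = 0%N by apply/eqP; rewrite -(eqn_add2r n) dn.
rewrite {}d0 in dimd.
have bound j : exists C : R, \forall alpha \near alpha0, forall x,
    zeros (member F alpha) x -> `|(x : 'rV[R]_n) ord0 j| <= C.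
  have [p p0] := krull_dim0_algebraic 'X_j (@uncountable_fraction_mpoly R m)
    (is_ideal_gen _) dimd.
  rewrite -(map_mpolyX (@tofrac {mpoly R[m]})) => /(algebraic_clear_denominators p0).
  move=> [P P0 PF].
  have noe : noetherian {mpoly R[m]} 1 := @noetherian_mpoly R m.
  have [N [g [c [pg gP]]]] := free_integral noe oU (is_ideal_gen F) free Ua0 P0 PF.
  have g0 : g.@[alpha0 ord0] != 0 by apply/eqP.
  have [C HC] := @bounded_roots_near R m N alpha0 g c g0.
  exists C; have Unear := rational_points_near oU Ua0.
  near=> alpha => x zx.
  have Ua : rational_points U alpha by near: alpha.
  have HCa : forall t : R,
    g.@[alpha ord0] * t ^+ N = \sum_(i < N) (c i).@[alpha ord0] * t ^+ i ->
    `|t| <= C by near: alpha.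
  apply: HCa; have := gP _ (point_ideal_spec zx).
  rewrite point_ideal_base => /(_ Ua) /eqP.
  rewrite rmorphB rmorphM rmorphXn subr_eq0 /= fevalC fevalX => /eqP ->.
  rewrite rmorph_sum; apply: eq_bigr => i _.
  by rewrite rmorphM rmorphXn /= fevalC fevalX.
have [C CP] := choice bound; exists C.
have : \forall alpha \near alpha0, forall j x,
    zeros (member F alpha) x -> `|(x : 'rV[R]_n) ord0 j| <= C j.
  exact: (@filter_forall _ _ (fun j alpha => forall x,
    zeros (member F alpha) x -> `|(x : 'rV[R]_n) ord0 j| <= C j)
    (nbhs alpha0) (nbhs_filter alpha0)).
by move=> near_all; near=> alpha => x zx j; move: j x zx; near: alpha.
Unshelve. all: by end_near. Qed.

End RealPoints.

(** For the maximum norm a ball is defined by one quadratic inequality for each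
    coordinate. *)
Lemma semialgebraic_ball (R : realType) (m : nat) (alpha0 : 'rV[R]_m) (e : R) :
  0 < e -> semialgebraic (ball alpha0 e).
Proof.
move=> e0.
pose s j : {mpoly R[m]} := (e ^+ 2)%:MP - ((alpha0 ord0 j)%:MP - 'X_j) ^+ 2.
exists [:: ([::], [seq s j | j <- enum 'I_m])].
have sE j (alpha : 'rV[R]_m) :
    (0 < (s j).@[alpha ord0]) = (`|alpha0 ord0 j - alpha ord0 j| < e).
  rewrite /s rmorphB /= mevalC rmorphXn rmorphB /= mevalC mevalXU subr_gt0.
  rewrite -(real_normK (num_real (alpha0 ord0 j - alpha ord0 j))).
  by rewrite ltr_pXn2r // nnegrE; [exact: normr_ge0|exact: ltW].
apply/seteqP; split=> alpha.
  move=> [_ Ba]; exists ([::], [seq s j | j <- enum 'I_m]); first exact: mem_head.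
  split=> //= _ /mapP[j _ ->]; rewrite sE.
  by have := Ba ord0 j; rewrite -ball_normE.
move=> [c]; rewrite inE => /eqP -> [_ /= H]; split=> // i j.
rewrite ord1 -ball_normE /ball_ /= -sE; apply: H.
by apply: map_f; rewrite mem_enum.
Qed.

Theorem theorem2p20 (R : realType) (n m : nat)
    (f : 'I_n -> {mpoly R[n]})
    (F : 'I_n -> {mpoly {mpoly R[m]}[n]})
    (U : set (set {mpoly R[m]})) (alphaI : 'rV[R]_m) (mu : nat) :
  zero_dim_complete_intersection f ->
  generically_zero_dim_family F f ->
  independent_parameters F ->
  I_optimal F U ->
  member F alphaI = f ->
  rational_points U alphaI ->
  zeros f #= `I_mu ->
  exists V : set 'rV[R]_m,
    [/\ V !=set0, open V, semialgebraic V, V `<=` rational_points U &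
        forall alpha, V alpha -> zeros (member F alpha) #= `I_mu].
Proof.
move=> _ [_ generic] _ optU memF Ua cardf.
have [C bnd] := zeros_bounded_near generic optU Ua.
have card_near : \forall alpha \near alphaI, zeros (member F alpha) #= `I_mu.
  apply: card_zeros_near bnd; last by rewrite memF.
  by move=> z; exact: smooth_zero optU Ua.
have [oU _ _ _] := optU.
have near_both : nbhs alphaI (rational_points U `&`
    [set alpha | zeros (member F alpha) #= `I_mu]).
  exact: filterI (rational_points_near oU Ua) card_near.
have [e /= e0 eV] := (nbhs_ballP _ _).1 near_both; exists (ball alphaI e); split.
- by exists alphaI; exact: ballxx.
- exact: ball_open.
- exact: semialgebraic_ball.
- by move=> alpha /eV[].
- by move=> alpha /eV[].
Qed.
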